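(* Let $M$ be compact, let $N=(0,\tau_{\max})\times M$ and let $g_j=-dt^2+h_{j,(t,x)}$, $j\in\mathbb N$, be Lorentzian metrics on $N$ such that each $(N,g_j)$ is a cosmological spacetime, i.e. $h_j(\partial_t,v)=0$ for every $v\in TN$. Denote by $h_{j,t}$ the restriction of $h_j$ to $\{t\}\times M$. Assume: 1. for each $j$, $h_j$ extends continuously to $t=0$ and $t=\tau_{\max}$ as a Riemannian metric; 2. $h_{j,t}\le h_{j+1,t}$ for all $j\in\mathbb N$ and all $t\in[0,\tau_{\max}]$; 3. there is a Riemannian metric $\tilde h$ on $M$ such that $h_{j,t}\le\tilde h$ on $TM$ for all $j\in\mathbb N$ and $t\in[0,\tau_{\max}]$. Denote by $d_\infty$ the distance obtained as the pointwise limit of the null distances $\hat d_j$ (extended to $[0,\tau_{\max}]\times M$). Then the convergence $\hat d_j\to d_\infty$ is uniform, and the sequence of associated timed metric spaces $(\bar N_j,\hat d_j,t)$ converges in the future developed Gromov-Hausdorff sense and in the timed-Hausdorff sense to the compact space $([0,\tau_{\max}]\times M,d_\infty)$ (with time function $t$).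
   Context: A spacetime is a connected smooth time-oriented Lorentzian manifold of signature $(-,+,\dots,+)$. A vector $v$ is causal if $v\neq 0$ and $g(v,v)\le0$. A cosmological spacetime is a spacetime $N=(0,\tau_{\max})\times M$ with metric $g=-dt^2+h$, where $h$ is a smooth symmetric 2-tensor on $N$ whose radical is spanned by $\partial_t$; each restriction $h_t=h|_{\{t\}\times M}$ is then a Riemannian metric on $M$; $N$ is time-oriented by $\partial_t$. Assumption 1 means the family $h_{j,t}$ extends continuously in $(t,x)$ to $t\in[0,\tau_{\max}]$ with $h_{j,0},h_{j,\tau_{\max}}$ Riemannian metrics. Inequalities between metrics are inequalities of quadratic forms. A piecewise causal curve is a continuous curve $\alpha:[a,b]\to N$ with a partition $a=s_0<\dots<s_n=b$ such that each $\alpha|_{(s_{i-1},s_i)}$ is smooth causal (future or past directed). Its null length is $\hat L(\alpha)=\sum_i|t(\alpha(s_i))-t(\alpha(s_{i-1}))|$ and the null distance $\hat d_j(p,q)$ is the infimum of $\hat L(\alpha)$ over $g_j$-piecewise causal curves from $p$ to $q$. The associated timed metric space of $(N,g_j)$ is the metric completion $(\bar N_j,\hat d_j)$ of $(N,\hat d_j)$ together with the continuous extension of the cosmological time $\tau=t$. Under assumption 1 the inclusion of $N$ identifies $\bar N_j$ with $[0,\tau_{\max}]\times M$ (homeomorphically), so all $\hat d_j$ are regarded as distances on $[0,\tau_{\max}]\times M$. A timed metric space is $(X,d,\tau)$ with $(X,d)$ a metric space and $\tau:X\to[0,\infty)$ 1-Lipschitz. It is future developed if, with $A=\tau^{-1}(0)$,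 $|A|\ge2$ and $\tau(p)=\operatorname{dist}(p,A)$ for all $p$. Metric pairs $(X_j,d_j,A_j)$ ($A_j\subset X_j$ closed) converge in the metric pair sense to $(X_\infty,d_\infty,A_\infty)$ if $$\lim_{j\to\infty}\inf\{\tilde d^H(\phi_j(X_j),\psi_j(X_\infty))+\tilde d^H(\phi_j(A_j),\psi_j(A_\infty))\}=0,$$ the infimum being over all metric spaces $(Z,\tilde d)$ and isometric (distance preserving) embeddings $\phi_j:X_j\to Z$, $\psi_j:X_\infty\to Z$, with $\tilde d^H$ the Hausdorff distance in $Z$. A sequence of future developed timed metric spaces $(X_j,d_j,\tau_j)$ converges in the future developed (Gromov-Hausdorff) sense to a future developed timed metric space $(X_\infty,d_\infty,\tau_\infty)$ if the metric pairs $(X_j,d_j,\tau_j^{-1}(0))$ converge in the metric pair sense to $(X_\infty,d_\infty,\tau_\infty^{-1}(0))$. Timed-Hausdorff convergence: for a compact timed metric space $(X,d,\tau)$ and a sequence $(x_i)_{i\ge1}$ dense in $X$, the associated timed-Fréchet map is $\kappa_\tau:X\to\ell^\infty$, $\kappa_\tau(x)=(\tau(x),d(x_1,x),d(x_2,x),\dots)$. The (intrinsic) timed-Hausdorff distance between two compact timed metric spaces $X$ and $Y$ is the infimum, over all choices of dense sequences in $X$ and in $Y$, of the Hausdorff distance in $\ell^\infty$ between $\kappa_{\tau_X}(X)$ and $\kappa_{\tau_Y}(Y)$. Timed-Hausdorff convergence means that this distance to the limit tends to $0$. *)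

(* Defs.v *)
From HB Require Import structures.
From mathcomp Require Import all_boot all_order all_algebra.
From mathcomp Require Import all_classical all_reals all_analysis.

Set Implicit Arguments.
Unset Strict Implicit.
Unset Printing Implicit Defensive.
Import Order.TTheory GRing.Theory Num.Theory.
Import numFieldNormedType.Exports.

Local Open Scope classical_set_scope.
Local Open Scope ring_scope.

(* Meant for U open and V finite-dimensional: f is then C^(k+1) iff it is
   differentiable with C^k directional derivatives. *)

Fixpoint Ck_on (R : realType) (V W : normedModType R) (k : nat)
    (U : set V) (f : V -> W) : Prop :=
  match k with
  | 0%N => forall x, U x -> {for x, continuous f}
  | k'.+1 => (forall x, U x -> differentiable f x) /\
             forall v, Ck_on k' U ('D_v f)
  end.

Definition smooth_on (R : realType) (V W : normedModType R)
    (U : set V) (f : V -> W) : Prop := forall k, Ck_on k U f.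

(* The inverse [param i] of the chart [coord i] is
   meaningful only on the image of [dom i]. *)

Record charts (R : realType) (E : normedModType R) (X : topologicalType) :=
  Charts {
    idx : Type;
    dom : idx -> set X;
    coord : idx -> X -> E;
    param : idx -> E -> X
  }.

Definition trans (R : realType) (E : normedModType R) (X : topologicalType)
    (A : charts E X) (i j : idx A) : E -> E := coord j \o param i.

Record smooth_atlas (R : realType) (E : normedModType R) (X : topologicalType)
    (A : charts E X) : Prop := SmoothAtlas {
  dom_open : forall i : idx A, open (dom i);
  image_open : forall i : idx A, open (coord i @` dom i);
  coord_cont : forall (i : idx A) x, dom i x -> {for x, continuous (coord i)};
  param_cont : forall (i : idx A) y, (coord i @` dom i) y ->
    {for y, continuous (param i)};
  coordK : forall (i : idx A) x, dom i x -> param i (coord i x) = x;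
  dom_cover : forall x, exists i : idx A, dom i x;
  trans_smooth : forall i j : idx A,
    smooth_on (coord i @` (dom i `&` dom j)) (trans i j)
}.

Definition time_charts (R : realType) (E : normedModType R)
    (X : topologicalType) (A : charts E X) :
    charts (R * E)%type (R * X)%type :=
  @Charts R (R * E)%type (R * X)%type (idx A)
    (fun i => [set p | dom i p.2])
    (fun i p => (p.1, coord i p.2))
    (fun i z => (z.1, param i z.2)).

(* A tangent vector at x is given by its components in a
   chart around x, and [h i x u v] is the value at x on the vectors whose
   components in the chart i are u and v. *)

Definition tensor2 (R : realType) (E : normedModType R) (X : topologicalType)
    (A : charts E X) := idx A -> X -> E -> E -> R.

Section tensors.
Variables (R : realType) (E : normedModType R) (X : topologicalType).
Variable A : charts E X.

Record sym2_on (U : set X) (h : tensor2 A) : Prop := Sym2On {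
  sym2_linear : forall i x u, U x -> dom i x -> scalar (h i x u);
  sym2_sym : forall i x u v, U x -> dom i x -> h i x u v = h i x v u;
  sym2_change : forall i j x u v, U x -> dom i x -> dom j x ->
    h i x u v = h j x ('d (trans i j) (coord i x) u)
                      ('d (trans i j) (coord i x) v)
}.

Definition tensor_smooth_on (U : set X) (h : tensor2 A) : Prop :=
  forall i u v, smooth_on (coord i @` (U `&` dom i))
                          (fun y => (h i (param i y) u v : R)).

Definition tensor_continuous (h : tensor2 A) : Prop :=
  forall i u v, {within dom i, continuous (fun x => h i x u v)}.

Definition tensor_posdef (h : tensor2 A) : Prop :=
  forall i x u, dom i x -> u != 0 -> 0 < h i x u u.

Definition riemannian (h : tensor2 A) : Prop :=
  [/\ sym2_on setT h, tensor_smooth_on setT h & tensor_posdef h].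

Definition C0_riemannian (h : tensor2 A) : Prop :=
  [/\ sym2_on setT h, tensor_continuous h & tensor_posdef h].

Definition tensor_le (h k : tensor2 A) : Prop :=
  forall i x u, dom i x -> h i x u u <= k i x u u.

End tensors.

(* Signature (-,+,...,+) of a symmetric bilinear form. *)
Definition lorentzian_form (R : realType) (V : normedModType R)
    (b : V -> V -> R) : Prop :=
  exists e, b e e < 0 /\ forall u, u != 0 -> b e u = 0 -> 0 < b u u.

(* The spacetime is the open subset ]0, T[ x M of R x M; its time function is
   the first projection, and tensor fields on it take arbitrary values
   elsewhere. *)

Section spacetime.
Variables (R : realType) (E : normedModType R) (M : topologicalType).
Variables (A : charts E M) (T : R).

Local Notation point := (R * M)%type.
Local Notation vector := (R * E)%type.
Local Notation A' := (time_charts A).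

Definition slab : set point := [set p | 0 < p.1 < T].
Definition closed_slab : set point := [set p | 0 <= p.1 <= T].

Definition del_t : vector := (1, 0).

Definition metric_of (h : tensor2 A') : tensor2 A' :=
  fun i p u v => - (u.1 * v.1) + h i p u v.

Record cosmological (h : tensor2 A') : Prop := Cosmological {
  cosmo_nonempty : slab !=set0;
  cosmo_connected : connected slab;
  cosmo_sym2 : sym2_on slab h;
  cosmo_smooth : tensor_smooth_on slab h;
  cosmo_radical : forall (i : idx A') p (u : vector), slab p -> dom i p ->
    (forall v, h i p u v = 0) <-> exists c : R, u = c *: del_t;
  cosmo_lorentzian : forall (i : idx A') p, slab p -> dom i p ->
    lorentzian_form (metric_of h i p)
}.

(* [hbar t] is the tensor h_t on M, for t in [0, T]. *)
Record extends_to_closed_slab (h : tensor2 A') (hbar : R -> tensor2 A) : Prop :=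
  ExtendsToClosedSlab {
  ext_restr : forall t x (i : idx A) (u v : E), 0 < t < T -> dom i x ->
    hbar t i x u v = h i (t, x) (0, u) (0, v);
  ext_cont : forall (i : idx A) (u v : E),
    {within [set p : point | 0 <= p.1 <= T /\ dom i p.2],
       continuous (fun p => hbar p.1 i p.2 u v)};
  ext_riem0 : C0_riemannian (hbar 0);
  ext_riemT : C0_riemannian (hbar T)
}.

Definition velocity (alpha : R -> point) (i : idx A') (s : R) : vector :=
  derive1 (coord i \o alpha) s.

Definition causal (h : tensor2 A') (i : idx A') (p : point) (v : vector) :=
  v != 0 /\ metric_of h i p v v <= 0.

Definition future_directed (h : tensor2 A') (i : idx A') p (v : vector) :=
  causal h i p v /\ metric_of h i p v del_t < 0.

Definition past_directed (h : tensor2 A') (i : idx A') p (v : vector) :=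
  causal h i p v /\ 0 < metric_of h i p v del_t.

Definition smooth_curve (a b : R) (alpha : R -> point) : Prop :=
  forall i : idx A',
    smooth_on (`]a, b[ `&` alpha @^-1` dom i) (coord i \o alpha).

Definition along (a b : R) (alpha : R -> point)
    (P : idx A' -> point -> vector -> Prop) : Prop :=
  forall s (i : idx A'), a < s < b -> dom i (alpha s) ->
    P i (alpha s) (velocity alpha i s).

Record piecewise_causal (h : tensor2 A') (n : nat) (s : nat -> R)
    (alpha : R -> point) : Prop := PiecewiseCausal {
  pc_partition : forall k, (k < n)%N -> s k < s k.+1;
  pc_slab : forall r, s 0%N <= r <= s n -> slab (alpha r);
  pc_cont : {within `[s 0%N, s n], continuous alpha};
  pc_smooth : forall k, (k < n)%N -> smooth_curve (s k) (s k.+1) alpha;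
  pc_causal : forall k, (k < n)%N ->
    along (s k) (s k.+1) alpha (future_directed h) \/
    along (s k) (s k.+1) alpha (past_directed h)
}.

Definition null_length (n : nat) (s : nat -> R) (alpha : R -> point) : R :=
  \sum_(k < n) `|(alpha (s k.+1)).1 - (alpha (s k)).1|.

Definition null_dist (h : tensor2 A') (p q : point) : R :=
  inf [set L | exists n s alpha, [/\ piecewise_causal h n s alpha,
                 alpha (s 0%N) = p, alpha (s n) = q
               & L = null_length n s alpha]].

Definition null_dist_bar (h : tensor2 A') (p q : point) : R :=
  lim (null_dist h x.1 x.2 @[x --> within (slab `*` slab) (nbhs (p, q))]).

End spacetime.

(* A metric space is given by a subset X of a type T and a function d on T,
   because many distances have to be considered on the same set. *)

Section metric_spaces.
Variables (R : realType).

Record is_metric (T : Type) (X : set T) (d : T -> T -> R) : Prop := IsMetric {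
  dist_eq0 : forall x y, X x -> X y -> (d x y = 0 <-> x = y);
  dist_sym : forall x y, X x -> X y -> d x y = d y x;
  dist_triangle : forall x y z, X x -> X y -> X z -> d x z <= d x y + d y z
}.

Definition metric_open (T : Type) (X : set T) (d : T -> T -> R) (U : set T) :=
  forall x, X x -> U x ->
    exists2 e, 0 < e & forall y, X y -> d x y < e -> U y.

Definition metric_compact (T : Type) (X : set T) (d : T -> T -> R) :=
  forall F : set (set T), F `<=` metric_open X d -> X `<=` \bigcup_(U in F) U ->
    exists G, [/\ G `<=` F, finite_set G & X `<=` \bigcup_(U in G) U].

Definition metric_complete (T : Type) (X : set T) (d : T -> T -> R) :=
  forall u : nat -> T, (forall k, X (u k)) ->
    (forall e, 0 < e -> exists K, forall k l,
       (K <= k)%N -> (K <= l)%N -> d (u k) (u l) < e) ->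
    exists2 x, X x & d (u k) x @[k --> \oo] --> (0 : R).

Record is_completion (T : Type) (X : set T) (d : T -> T -> R)
    (Xbar : set T) (dbar : T -> T -> R) : Prop := IsCompletion {
  compl_metric : is_metric Xbar dbar;
  compl_complete : metric_complete Xbar dbar;
  compl_sub : X `<=` Xbar;
  compl_agree : forall x y, X x -> X y -> dbar x y = d x y;
  compl_dense : forall x e, Xbar x -> 0 < e ->
    exists2 y, X y & dbar x y < e
}.

Definition induces_topology (T : topologicalType) (X : set T)
    (d : T -> T -> R) : Prop :=
  forall U : set T, metric_open X d U <-> open (U : set (subspace X)).

Record timed_metric_space (T : Type) (X : set T) (d : T -> T -> R)
    (tau : T -> R) : Prop := TimedMetricSpace {
  tms_metric : is_metric X d;
  tms_ge0 : forall x, X x -> 0 <= tau x;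
  tms_lip : forall x y, X x -> X y -> `|tau x - tau y| <= d x y
}.

Definition initial_set (T : Type) (X : set T) (tau : T -> R) : set T :=
  X `&` tau @^-1` [set 0].

Record future_developed (T : Type) (X : set T) (d : T -> T -> R)
    (tau : T -> R) : Prop := FutureDeveloped {
  fd_timed : timed_metric_space X d tau;
  fd_card : exists a b, [/\ initial_set X tau a, initial_set X tau b & a <> b];
  fd_dist : forall x, X x -> tau x = inf [set d x a | a in initial_set X tau]
}.

Local Open Scope ereal_scope.

Definition hausdorff_dist (Z : Type) (d : Z -> Z -> \bar R) (A B : set Z) :
    \bar R :=
  ereal_inf [set r%:E | r in [set r : R | [/\ (0 <= r)%R,
    forall a, A a -> exists2 b, B b & d a b <= r%:E
  & forall b, B b -> exists2 a, A a & d a b <= r%:E]]].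

Definition isometric_on (T : Type) (X : set T) (d : T -> T -> R)
    (Z : metricType R) (phi : T -> Z) : Prop :=
  forall x y, X x -> X y -> mdist (phi x) (phi y) = d x y.

Definition metric_pair_dist (T : Type) (X : set T) (dX : T -> T -> R)
    (A : set T) (T' : Type) (Y : set T') (dY : T' -> T' -> R) (B : set T') :
    \bar R :=
  ereal_inf [set r | exists (Z : metricType R) (phi : T -> Z) (psi : T' -> Z),
    [/\ isometric_on X dX phi, isometric_on Y dY psi
      & r = hausdorff_dist (fun z w => (mdist z w)%:E) (phi @` X) (psi @` Y) +
            hausdorff_dist (fun z w => (mdist z w)%:E) (phi @` A) (psi @` B)]].

Definition metric_pair_cvg (T : Type) (X : nat -> set T)
    (d : nat -> T -> T -> R) (A : nat -> set T)
    (T' : Type) (Y : set T') (dY : T' -> T' -> R) (B : set T') : Prop :=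
  metric_pair_dist (X j) (d j) (A j) Y dY B @[j --> \oo] --> 0.

Definition future_developed_cvg (T : Type) (X : nat -> set T)
    (d : nat -> T -> T -> R) (tau : nat -> T -> R)
    (T' : Type) (Y : set T') (dY : T' -> T' -> R) (tauY : T' -> R) : Prop :=
  [/\ forall j, future_developed (X j) (d j) (tau j),
      future_developed Y dY tauY
    & metric_pair_cvg X d (fun j => initial_set (X j) (tau j))
                      Y dY (initial_set Y tauY)].

Definition dense_seq (T : Type) (X : set T) (d : T -> T -> R) (xs : nat -> T) :=
  (forall i, X (xs i)) /\
  forall x e, X x -> (0 < e)%R -> exists i, (d (xs i) x < e)%R.

Definition timed_frechet (T : Type) (d : T -> T -> R) (tau : T -> R)
    (xs : nat -> T) (x : T) : nat -> R :=
  fun k => if k is k'.+1 then d (xs k') x else tau x.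

Definition linf_dist (u v : nat -> R) : \bar R :=
  ereal_sup [set `|u k - v k|%:E | k in [set: nat]].

Definition timed_hausdorff_dist (T : Type) (X : set T) (dX : T -> T -> R)
    (tauX : T -> R) (T' : Type) (Y : set T') (dY : T' -> T' -> R)
    (tauY : T' -> R) : \bar R :=
  ereal_inf [set r | exists xs ys, [/\ dense_seq X dX xs, dense_seq Y dY ys
    & r = hausdorff_dist linf_dist (timed_frechet dX tauX xs @` X)
                                   (timed_frechet dY tauY ys @` Y)]].

Definition compact_timed (T : Type) (X : set T) (d : T -> T -> R)
    (tau : T -> R) : Prop := timed_metric_space X d tau /\ metric_compact X d.

Definition timed_hausdorff_cvg (T : Type) (X : nat -> set T)
    (d : nat -> T -> T -> R) (tau : nat -> T -> R)
    (T' : Type) (Y : set T') (dY : T' -> T' -> R) (tauY : T' -> R) : Prop :=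
  [/\ forall j, compact_timed (X j) (d j) (tau j),
      compact_timed Y dY tauY
    & timed_hausdorff_dist (X j) (d j) (tau j) Y dY tauY @[j --> \oo] --> 0].

End metric_spaces.

(* Main.v *)
From HB Require Import structures.
Require Import Defs.
From mathcomp Require Import all_boot all_order all_algebra.
From mathcomp Require Import all_classical all_reals all_analysis.
From mathcomp Require Import ring lra.

(** The null cone of [g_j] at a vector [v] is given by [h_j(v, v) = dt(v)^2],
    so that [t] is strictly monotone along a causal curve, its null length is
    the total variation of [t], and its spatial speed is at most the speed of
    [t].  Two local estimates follow, both uniform in [j] because
    [h_0 <= h_j <= htilde].

    From above: in a chart around a point, [htilde] is at most [C^2] times the
    square of the norm, so a straight segment of the chart is causal as soon
    as [t] varies by at least [C] times its length.  Nearby points are joined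
    by such a segment, run upwards or downwards so as to stay in the slab,
    followed by a vertical line (reach_segment, reach_vertical,
    reach_locally).  By connectedness any two points of the slab are joined,
    with a null length bounded independently of [j] (reach_all).

    From below: in a chart around a point, which may lie on the boundary of
    the slab, [h_0] is at least [c] times the square of the norm.  By the mean
    value inequality a curve of null length [L] moves by at most [K L] in the
    chart while it stays there, and a continuity argument shows that it cannot
    leave the chart if [L] is small (mean_value_cone, piece_trapped,
    reach_trapped).  So distinct points of the closed slab have neighbourhoods
    at positive null distance (reach_separated).

    The rest is metric topology on the compact closed slab.  The upper
    estimate makes the null distance Cauchy at the boundary; its limit there
    is a metric by the lower estimate (lim_is_metric), and a metric which is
    continuous on a compact space induces its topology and is complete
    (compact_induces_topology, compact_metric_complete).  Enlarging [h]
    shrinks the causal cones, so the distances increase with [j]; being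
    bounded they converge, and being equicontinuous they converge uniformly
    (dinf_uniform).

    Uniform convergence gives both notions of convergence.  The embeddings
    [x |-> d(x, _)] of the closed slab into the space of bounded functions,
    for [d = d_j] and [d = d_infty], are isometric and uniformly close to each
    other (metric_pair_dist_le).  A sequence dense for [d_infty] is dense for
    the smaller [d_j] as well, and the timed-Frechet maps built from it are
    uniformly close (timed_hausdorff_dist_le).  Finally the distance to the
    initial slice is [t], because [t] is 1-Lipschitz and vertical lines are
    causal (slab_future_developed). *)

Set Implicit Arguments.
Unset Strict Implicit.
Unset Printing Implicit Defensive.
Import Order.TTheory GRing.Theory Num.Theory.
Import numFieldNormedType.Exports.
Local Open Scope classical_set_scope.
Local Open Scope ring_scope.
(* [coord] denotes the coordinate map of a chart. *)
Import Defs.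

(** * Smooth maps *)

Section smooth_maps.
Variable R : realType.
Implicit Types V W : normedModType R.

(** Smoothness on an open set is defined through global derivatives
    [ 'D_v f ], so each of its uses needs to know that differentials only depend
    on germs. *)
Lemma near_eq_diff V W (f g : V -> W) (x : V) :
  (\forall y \near x, f y = g y) -> differentiable f x ->
  differentiable g x /\ 'd g x = 'd f x :> (V -> W).
Proof.
move=> fg df.
have fgx : f x = g x by exact: nbhs_singleton fg.
have dfc : continuous ('d f x) by exact: diff_continuous.
have gE : g \o shift x = cst (g x) + 'd f x +o_ 0 id.
  apply/eqaddoP => e e0.
  have /eqaddoP/(_ e e0) := diff_locally df.
  apply: filter_app.
  have : \forall y \near (0 : V), f (y + x) = g (y + x).
    have sx : y + x @[y --> (0 : V)] --> x.
      by rewrite -[X in _ --> X]add0r; apply: cvgD; [exact: cvg_id|exact: cvg_cst].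
    exact: sx fg.
  apply: filterS => y fgy.
  by rewrite /= !fctE /= fgy fgx.
have dg := diff_unique dfc gE.
split; last by [].
apply/diff_locallyP; rewrite dg; split; [exact: dfc|exact: gE].
Unshelve. all: by end_near. Qed.

(** Openness is essential: it turns equality on [U] into equality of germs,
    which the directional derivatives inherit. *)
Lemma Ck_on_eq V W k (U : set V) (f g : V -> W) :
  open U -> (forall x, U x -> f x = g x) -> Ck_on k U f -> Ck_on k U g.
Proof.
move=> oU; elim: k f g => [|k IH] f g fg /=.
  move=> cf x Ux; rewrite /prop_for /continuous_at -fg//.
  apply: cvg_trans (cf x Ux); apply: near_eq_cvg.
  by near=> y; apply: fg; near: y; exact: open_nbhs_nbhs.
move=> [df Df].
have nfg x : U x -> \forall y \near x, f y = g y.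
  by move=> Ux; near=> y; apply: fg; near: y; exact: open_nbhs_nbhs.
split=> [x Ux|v]; first exact: (near_eq_diff (nfg x Ux) (df x Ux)).1.
by apply: IH (Df v) => x Ux; apply: near_eq_derive; exact: nfg.
Unshelve. all: by end_near. Qed.

Lemma Ck_on_sub V W k (U U' : set V) (f : V -> W) :
  U `<=` U' -> Ck_on k U' f -> Ck_on k U f.
Proof.
move=> UU'; elim: k f => [|k IH] f /=; first by move=> cf x /UU'; exact: cf.
by move=> [df Df]; split=> [x /UU'/df//|v]; exact: IH.
Qed.

Lemma smooth_on_eq V W (U : set V) (f g : V -> W) :
  open U -> (forall x, U x -> f x = g x) -> smooth_on U f -> smooth_on U g.
Proof. by move=> oU fg sf k; exact: Ck_on_eq (sf k). Qed.

Lemma smooth_on_sub V W (U U' : set V) (f : V -> W) :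
  U `<=` U' -> smooth_on U' f -> smooth_on U f.
Proof. by move=> UU' sf k; exact: Ck_on_sub (sf k). Qed.

Lemma smooth_on_cst V W (U : set V) (w : W) : smooth_on U (fun=> w : W).
Proof.
move=> k; elim: k w => [|k IH] w /=; first by move=> x _; exact: cvg_cst.
split=> [x _|v]; first exact: differentiable_cst.
suff -> : 'D_v (fun=> w) = fun _ : V => 0 by exact: IH.
by apply/funext => x; rewrite derive_cst.
Qed.

Lemma smooth_on_id V (U : set V) : smooth_on U (@id V).
Proof.
move=> [|k] /=; first by move=> x _; exact: cvg_id.
split=> [x _|v]; first exact: ex_diff.
suff -> : 'D_v id = fun _ : V => v by exact: smooth_on_cst.
by apply/funext => x; rewrite derive_id.
Qed.

Lemma smooth_on_pair V W W' (U : set V) (f : V -> W) (g : V -> W') :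
  open U -> smooth_on U f -> smooth_on U g ->
  smooth_on U (fun x => (f x, g x)).
Proof.
move=> oU sf sg k; move: (sf k) (sg k) => {sf sg}.
elim: k f g => [|k IH] f g /=.
  by move=> cf cg x Ux; apply: cvg_pair; [exact: cf|exact: cg].
move=> [df Df] [dg Dg]; split=> [x Ux|v].
  by apply: differentiable_pair; [exact: df|exact: dg].
apply: (Ck_on_eq oU _ (IH _ _ (Df v) (Dg v))) => x Ux.
have dfx := df x Ux; have dgx := dg x Ux.
rewrite [RHS]deriveE; last exact: differentiable_pair.
by rewrite diff_pair// !deriveE.
Qed.

Lemma is_diff_line V (z v : V) (s : R) :
  is_diff s (fun s : R => z + s *: v) (fun s : R => s *: v).
Proof.
rewrite (_ : (fun s : R => s *: v) = 0 + (fun s : R => s *: v)); last first.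
  by apply/funext => r /=; rewrite fctE add0r.
exact: is_diffD.
Qed.

Lemma continuous_line V (z v : V) : continuous (fun s : R => z + s *: v).
Proof. by move=> s; apply: differentiable_continuous; have [] := is_diff_line z v s. Qed.

(** The derivative of the composite in the direction [w] is the composite of
    ['D_(w *: v) f] with the line, so the induction on the order goes through.
    The case [V = R] serves for reparametrizations. *)
Lemma smooth_on_line V W (U : set V) (f : V -> W) (z v : V) :
  open U -> smooth_on U f ->
  smooth_on [set s : R | U (z + s *: v)] (fun s : R => f (z + s *: v)).
Proof.
move=> oU sf k; move: (sf k) => {sf}.
have oL : open [set s : R | U (z + s *: v)].
  by apply: open_comp => // s _; exact: continuous_line.
elim: k f => [|k IH] f /=.
  move=> cf s Us; apply: (@continuous_comp _ _ _ (fun s : R => z + s *: v) f).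
    exact: continuous_line.
  exact: cf.
have ds s := is_diff_line z v s.
move=> [df Df]; split=> [s Us|w].
  exact: (differentiable_comp (@ex_diff _ _ _ _ _ _ _ (ds s)) (df _ Us)).
apply: (Ck_on_eq oL _ (IH _ (Df (w *: v)))) => s Us.
have dfs := df _ Us; have dl := @ex_diff _ _ _ _ _ _ _ (ds s).
rewrite [RHS]deriveE; last exact: (differentiable_comp dl dfs).
rewrite (diff_comp dl dfs)/= (@diff_val _ _ _ _ _ _ _ (ds s)).
by rewrite deriveE.
Qed.

Lemma linear_scale W (df : {linear R -> W}) (a : R) : df a = a *: df 1.
Proof.
have := linearZ_LR df a 1.
by have -> : a *: (1 : R) = a by exact: mulr1.
Qed.

(** The chain rule for the affine reparametrization [r |-> c + r *: sg] of a
    curve; [sg] is [1] for a shift and [-1] for a reversal. *)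
Lemma derive1_line W (f : R -> W) (c sg r : R) :
  differentiable f (c + r *: sg) ->
  (fun r => f (c + r *: sg))^`()%classic r = sg *: f^`()%classic (c + r *: sg).
Proof.
move=> df; have dl := is_diff_line c sg r.
have dl' := @ex_diff _ _ _ _ _ _ _ dl.
rewrite derive1E'; last exact: (differentiable_comp dl' df).
rewrite (diff_comp dl' df) /= (@diff_val _ _ _ _ _ _ _ dl) derive1E'// scale1r.
exact: linear_scale.
Qed.

End smooth_maps.

(** * Causal vectors in a cosmological spacetime *)

Section scalar_forms.
Variables (R : realType) (V : lmodType R) (b : V -> R).
Hypothesis lb : scalar b.

Lemma scalar0 : b 0 = 0.
Proof. by have := lb (-1) 0 0; rewrite scaler0 addr0 /= mulN1r addNr. Qed.

Lemma scalarZ a u : b (a *: u) = a * b u.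
Proof. by have := lb a u 0; rewrite addr0 scalar0 addr0. Qed.
End scalar_forms.

Section itv_continuity.
Variables (R : realType) (T : topologicalType).
Implicit Types (a b : R) (f : R -> T).

Lemma within_itv_continuous a b f (r : R) :
  {within `[a, b], continuous f} -> a < r < b -> {for r, continuous f}.
Proof.
move=> cf rab.
have sub : `]a, b[ `<=` `[a, b] by move=> x /=; rewrite !in_itv/= => /andP[/ltW-> /ltW->].
have := continuous_subspaceW sub cf.
rewrite continuous_open_subspace; last exact: itv_open.
by apply; rewrite inE/= in_itv.
Qed.

Lemma open_itv_preimage a b f (D : set T) :
  {within `[a, b], continuous f} -> open D -> open (`]a, b[ `&` f @^-1` D).
Proof.
move=> cf oD; rewrite openE => r [/= rab Dfr].
have {}rab : a < r < b by rewrite in_itv/= in rab.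
apply: filterI; first by apply: open_nbhs_nbhs; split; [exact: itv_open|rewrite /= in_itv].
by apply: (within_itv_continuous cf rab); exact: open_nbhs_nbhs.
Qed.

Lemma within_continuous_comp (S : topologicalType) (X : set S) (Y : set R)
    (g : S -> R) f : continuous g -> (forall x, X x -> Y (g x)) ->
  {within Y, continuous f} -> {within X, continuous (f \o g)}.
Proof.
move=> cg gXY /subspace_continuousP cf; apply/subspace_continuousP => x Xx.
move=> B fB; have gB := cf _ (gXY _ Xx) B fB.
have gB' : \forall z \near g x, Y z -> B (f z) by exact: gB.
have : \forall y \near x, Y (g y) -> B (f (g y)) by exact: cg gB'.
by apply: filterS => y gy Xy; apply: gy; exact: gXY.
Qed.
End itv_continuity.

Section causal_curves.
Variables (R : realType) (E : normedModType R) (M : topologicalType).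
Variables (A : charts E M) (T : R).
Hypothesis atlasA : smooth_atlas A.
Local Notation A' := (time_charts A).
Local Notation point := (R * M)%type.
Local Notation vector := (R * E)%type.

Lemma open_time_dom (i : idx A') : open (dom i).
Proof.
have -> : dom i = snd @^-1` (dom (i : idx A)) :> set point by [].
by apply: open_comp => [? _|]; [exact: cvg_snd|exact: dom_open].
Qed.

Lemma paramK (i : idx A) y : (coord i @` dom i) y ->
  dom i (param i y) /\ coord i (param i y) = y.
Proof. by case=> x dx <-; rewrite (coordK atlasA). Qed.

(** The transition map is smooth on this set; the smoothness of a composite
    can be transported only because the set is open. *)
Lemma open_overlap (i k : idx A) : open (coord i @` (dom i `&` dom k)).
Proof.
rewrite openE => _ [x [dx dkx] <-].
have ix : (coord i @` dom i) (coord i x) by exists x.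
have h1 : \forall y \near coord i x, (coord i @` dom i) y.
  by apply: open_nbhs_nbhs; split=> //; exact: image_open.
have h2 : \forall y \near coord i x, dom k (param i y).
  apply: (param_cont atlasA ix); rewrite (coordK atlasA)//.
  by apply: open_nbhs_nbhs; split=> //; exact: dom_open.
near=> y.
have [dy cy] : dom i (param i y) /\ coord i (param i y) = y.
  by apply: paramK; near: y.
by exists (param i y) => //; split=> //; near: y.
Unshelve. all: by end_near. Qed.

Section one_metric.
Variables (h : tensor2 A') (hbar : R -> tensor2 A).
Hypothesis cosmo : cosmological T h.
Hypothesis ext : extends_to_closed_slab T h hbar.
Local Notation slab := (@slab R M T).

Lemma del_t_radical i p (v : vector) : slab p -> dom (i : idx A') p ->
  h i p v (@del_t R E) = 0.
Proof.
move=> sp dp; rewrite (sym2_sym (cosmo_sym2 cosmo))//.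
apply: (proj2 (cosmo_radical cosmo (@del_t R E) sp dp)).
by exists 1; rewrite scale1r.
Qed.

(** As [del_t] spans the radical of [h], only the spatial part of a vector
    contributes to [h]: the metric splits as [- dt^2 + h_t]. *)
Lemma metric_ofE i p (v : vector) : slab p -> dom (i : idx A') p ->
  metric_of h i p v v = - v.1 ^+ 2 + hbar p.1 i p.2 v.2 v.2.
Proof.
move=> sp dp; rewrite /metric_of -expr2; congr (_ + _).
rewrite (ext_restr ext)//.
have sy := cosmo_sym2 cosmo.
have L w : h i p w v = h i p w (0, v.2).
  have -> : v = v.1 *: (@del_t R E) + (0, v.2).
    rewrite [LHS]surjective_pairing [RHS]surjective_pairing; congr (_, _) => /=.
      by rewrite addr0 [_ *: _]mulr1.
    by rewrite scaler0 add0r.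
  by rewrite /= (sym2_linear sy)//= del_t_radical// mulr0 add0r scaler0 add0r.
by rewrite -surjective_pairing L (sym2_sym sy)// L.
Qed.

(** In this form causality compares the spatial speed with the speed of [t];
    a vector with [0 < v.1] is automatically nonzero. *)
Lemma future_directedE i p (v : vector) : slab p -> dom (i : idx A') p ->
  future_directed h i p v <-> 0 < v.1 /\ hbar p.1 i p.2 v.2 v.2 <= v.1 ^+ 2.
Proof.
move=> sp dp; rewrite /future_directed /causal metric_ofE//.
rewrite {1}/metric_of del_t_radical//= mulr1 addr0 oppr_lt0 addrC subr_le0.
split=> [[[_ ?] ?]//|[v0 ?]]; split=> //; split=> //.
by apply: contraTneq v0 => ->; rewrite ltxx.
Qed.

Lemma past_directedE i p (v : vector) : slab p -> dom (i : idx A') p ->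
  past_directed h i p v <-> v.1 < 0 /\ hbar p.1 i p.2 v.2 v.2 <= v.1 ^+ 2.
Proof.
move=> sp dp; rewrite /past_directed /causal metric_ofE//.
rewrite {1}/metric_of del_t_radical//= mulr1 addr0 oppr_gt0 addrC subr_le0.
split=> [[[_ ?] ?]//|[v0 ?]]; split=> //; split=> //.
by apply: contraTneq v0 => ->; rewrite ltxx.
Qed.

Lemma hbarN i p (v : E) : slab p -> dom (i : idx A) p.2 ->
  hbar p.1 i p.2 (- v) (- v) = hbar p.1 i p.2 v v.
Proof.
move=> sp dp; rewrite !(ext_restr ext)//.
have sy := cosmo_sym2 cosmo.
have L w : h i (p.1, p.2) w (0, - v) = - h i (p.1, p.2) w (0, v).
  have -> : (0, - v) = (-1) *: (0, v) :> vector.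
    by rewrite [RHS]surjective_pairing; congr (_, _); rewrite /= ?scaler0 ?scaleN1r.
  by rewrite (scalarZ (sym2_linear sy w (sp : slab (p.1, p.2)) dp)) mulN1r.
by rewrite L (sym2_sym sy)// L opprK.
Qed.

Lemma future_directedN i p (v : vector) : slab p -> dom (i : idx A') p ->
  future_directed h i p (- v) <-> past_directed h i p v.
Proof.
move=> sp dp; rewrite future_directedE// past_directedE//= hbarN//.
by rewrite oppr_gt0 sqrrN.
Qed.

End one_metric.
End causal_curves.

(** * Operations on piecewise causal curves *)

Section operations.
Variables (R : realType) (E : normedModType R) (M : topologicalType).
Variables (A : charts E M) (T : R).
Hypothesis atlasA : smooth_atlas A.
Local Notation A' := (time_charts A).
Local Notation point := (R * M)%type.
Local Notation vector := (R * E)%type.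
Local Notation slab := (@slab R M T).

Lemma partition_le (s : nat -> R) n i j :
  (forall k, (k < n)%N -> s k < s k.+1) -> (i <= j <= n)%N -> s i <= s j.
Proof.
move=> sS; elim: j => [|j IH]; first by rewrite leqn0 => /andP[/eqP->].
move=> /andP[]; rewrite leq_eqVlt => /predU1P[->//|ij jn].
apply: (@le_trans _ _ (s j)); first by apply: IH; rewrite -ltnS ij ltnW.
exact/ltW/sS.
Qed.

(** A piece of a concatenated curve agrees with the given one only on the
    open interval, which is enough because its preimage of a chart domain is
    open. *)
Lemma smooth_curve_eq (a b : R) (alpha beta : R -> point) :
  {within `[a, b], continuous alpha} ->
  (forall r, a < r < b -> alpha r = beta r) ->
  smooth_curve A a b alpha -> smooth_curve A a b beta.
Proof.
move=> ca eab sa i.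
have -> : `]a, b[ `&` beta @^-1` dom (i : idx A') = `]a, b[ `&` alpha @^-1` dom (i : idx A').
  by apply/seteqP; split=> r /= [rab]; move: (rab); rewrite in_itv/= => /eab ->.
apply: smooth_on_eq (sa i).
  by apply: open_itv_preimage ca _; exact: open_time_dom.
by move=> r /= [rab _]; move: rab; rewrite in_itv/= => /eab ->.
Qed.

Lemma along_eq (a b : R) (alpha beta : R -> point)
    (P : idx A' -> point -> vector -> Prop) :
  (forall r, a < r < b -> alpha r = beta r) ->
  along a b alpha P -> along a b beta P.
Proof.
move=> eab Pa r i rab; rewrite -eab// => dr.
rewrite (_ : velocity beta i r = velocity alpha i r); first exact: Pa.
rewrite /velocity !derive1E; apply: near_eq_derive.
have : \forall x \near r, a < x < b.
  by near=> x; rewrite -[_ && _]/(x \in `]a, b[); near: x; exact: near_in_itvoo.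
by apply: filterS => x /eab/= ->.
Unshelve. all: by end_near. Qed.

Section reparametrization.
Variables (a b a' b' c sg : R) (alpha : R -> point).
Hypothesis ca : {within `[a, b], continuous alpha}.
Hypothesis phi_itv : forall r, a' < r < b' -> a < c + r *: sg < b.

Lemma smooth_curve_line : smooth_curve A a b alpha ->
  smooth_curve A a' b' (fun r => alpha (c + r *: sg)).
Proof.
move=> sa i.
have oU := open_itv_preimage ca (@open_time_dom _ _ _ _ atlasA i).
apply: smooth_on_sub (smooth_on_line c sg oU (sa i)).
by move=> r /= [+ dr]; rewrite in_itv/= => /phi_itv rab; split=> //=; rewrite in_itv.
Qed.

Lemma velocity_line i r : smooth_curve A a b alpha -> a' < r < b' ->
  dom (i : idx A') (alpha (c + r *: sg)) ->
  velocity (fun r => alpha (c + r *: sg)) i r = sg *: velocity alpha i (c + r *: sg).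
Proof.
move=> sa rab dr.
have [df _] := sa i 1%N.
have {}df : differentiable (coord i \o alpha) (c + r *: sg).
  by apply: df; split=> //=; rewrite in_itv/= phi_itv.
exact: derive1_line df.
Qed.
End reparametrization.

Section one_metric.
Variables (h : tensor2 A') (hbar : R -> tensor2 A).
Hypothesis cosmo : cosmological T h.
Hypothesis ext : extends_to_closed_slab T h hbar.

Lemma pc_sub n s alpha k : piecewise_causal T h n s alpha -> (k < n)%N ->
  `[s k, s k.+1] `<=` `[s 0%N, s n].
Proof.
move=> pc kn r /=; rewrite !in_itv/= => /andP[kr rk].
have sS := pc_partition pc.
rewrite (le_trans _ kr) ?(le_trans rk)//; apply: (partition_le sS).
  by rewrite leqnn andbT.
by rewrite leq0n/= ltnW.
Qed.

Lemma pc_cont_piece n s alpha k : piecewise_causal T h n s alpha -> (k < n)%N ->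
  {within `[s k, s k.+1], continuous alpha}.
Proof.
move=> pc kn; apply: continuous_subspaceW (pc_cont pc).
exact: (pc_sub pc kn).
Qed.

Lemma pc_slab_piece n s alpha k r : piecewise_causal T h n s alpha -> (k < n)%N ->
  s k < r < s k.+1 -> slab (alpha r).
Proof.
move=> pc kn rk; apply: (pc_slab pc); have := @pc_sub _ _ _ _ pc kn r.
rewrite /= !in_itv/=; apply.
by move: rk => /andP[/ltW-> /ltW->].
Qed.

(** Parameters are shifted so that two curves to be concatenated have
    consecutive intervals of definition. *)
Lemma pc_shift n s alpha c : piecewise_causal T h n s alpha ->
  piecewise_causal T h n (fun k => s k - c) (fun r => alpha (c + r *: 1)).
Proof.
move=> pc.
have phi k (r : R) : s k - c < r < s k.+1 - c -> s k < (c + r *: 1 : R) < s k.+1.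
  by rewrite [r *: 1]mulr1 ltrBlDl ltrBrDl.
split.
- by move=> k kn; rewrite ltrD2r (pc_partition pc).
- by move=> r; rewrite lerBlDl lerBrDl => rs; apply: (pc_slab pc); rewrite [r *: 1]mulr1.
- rewrite -[fun r => alpha _]/(alpha \o (fun r : R => c + r *: 1)).
  apply: within_continuous_comp (pc_cont pc).
    exact: continuous_line.
  by move=> r /=; rewrite !in_itv/= [r *: 1]mulr1 lerBlDl lerBrDl.
- move=> k kn; apply: (smooth_curve_line (a := s k) (b := s k.+1)) (pc_smooth pc kn).
    exact: pc_cont_piece kn.
  exact: phi.
- move=> k kn.
  have V (r : R) i : s k - c < r < s k.+1 - c -> dom (i : idx A') (alpha (c + r *: 1)) ->
      velocity (fun r => alpha (c + r *: 1)) i r = velocity alpha i (c + r *: 1).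
    move=> rk dr; rewrite -[RHS]scale1r.
    by apply: (velocity_line _ (pc_smooth pc kn) rk dr); exact: phi.
  by have [F|P] := pc_causal pc kn; [left|right] => r i rk dr;
    rewrite V//; [apply: F|apply: P]=> //; exact: phi.
Qed.

(** Reversal exchanges the future and the past directed pieces, since
    velocities change sign. *)
Lemma pc_reverse n s alpha : piecewise_causal T h n s alpha ->
  piecewise_causal T h n (fun k => - s (n - k)%N) (fun r => alpha (0 + r *: (-1))).
Proof.
move=> pc.
have lineE r : 0 + r *: (-1) = - r :> R by rewrite add0r [_ *: _]mulrN1.
have phi k (r : R) : (k < n)%N -> - s (n - k)%N < r < - s (n - k.+1)%N ->
    s (n - k.+1)%N < (0 + r *: (-1) : R) < s (n - k.+1).+1%N.
  move=> kn; rewrite lineE -subSn// subSS => /andP[h1 h2].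
  by rewrite ltrNr h2 ltrNl h1.
have nk k : (k < n)%N -> (n - k.+1 < n)%N.
  by move=> kn; rewrite -subSn// subSS leq_subr.
split.
- move=> k kn; rewrite ltrN2.
  by have := pc_partition pc (nk _ kn); rewrite -subSn// subSS.
- move=> r; rewrite subn0 subnn => /andP[h1 h2]; apply: (pc_slab pc).
  by rewrite lineE lerNr h2 lerNl h1.
- rewrite -[fun r => alpha _]/(alpha \o (fun r : R => 0 + r *: (-1))).
  apply: within_continuous_comp (pc_cont pc).
    exact: continuous_line.
  move=> r /=; rewrite !in_itv/= lineE subn0 subnn => /andP[h1 h2].
  by rewrite lerNr h2 lerNl h1.
- move=> k kn; apply: (smooth_curve_line _ _ (pc_smooth pc (nk _ kn))).
    exact: pc_cont_piece (nk _ kn).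
  by move=> r; exact: phi.
- move=> k kn.
  have V (r : R) i : - s (n - k)%N < r < - s (n - k.+1)%N ->
      dom (i : idx A') (alpha (0 + r *: (-1))) ->
      velocity (fun r => alpha (0 + r *: (-1))) i r =
      - velocity alpha i (0 + r *: (-1)).
    move=> rk dr; rewrite -[RHS]scaleN1r.
    apply: (velocity_line _ (pc_smooth pc (nk _ kn)) rk dr) => r'.
    exact: phi.
  have sl r rk := pc_slab_piece pc (nk _ kn) (phi k r kn rk).
  have [F|P] := pc_causal pc (nk _ kn); [right|left] => r i rk dr; rewrite V//.
    have H := future_directedN cosmo ext (- velocity alpha i (0 + r *: (-1))) (sl _ rk) dr.
    by apply/H; rewrite opprK; exact: F _ _ (phi _ _ kn rk) dr.
  have H := future_directedN cosmo ext (velocity alpha i (0 + r *: (-1))) (sl _ rk) dr.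
  by apply/H; exact: P _ _ (phi _ _ kn rk) dr.
Qed.

(** At the junction only continuity is required, so two closed intervals can
    simply be glued. *)
Lemma pc_cat n s alpha m t beta : piecewise_causal T h n s alpha ->
  piecewise_causal T h m t beta -> s n = t 0%N -> alpha (s n) = beta (t 0%N) ->
  piecewise_causal T h (n + m) (fun k => if (k <= n)%N then s k else t (k - n)%N)
    (fun r => if r <= s n then alpha r else beta r).
Proof.
move=> pa pb st ab.
set u := (fun k => if _ then _ else _); set gam := (fun r => if _ then _ else _).
have uE k : u (n + k)%N = t k.
  rewrite /u; case: ifPn => [|_]; last by rewrite addKn.
  by rewrite -{2}(addn0 n) leq_add2l leqn0 => /eqP ->; rewrite addn0.
have ul k : (k <= n)%N -> u k = s k by rewrite /u => ->.
have s0n : s 0%N <= s n by apply: (partition_le (pc_partition pa)); rewrite leqnn.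
have t0m : t 0%N <= t m by apply: (partition_le (pc_partition pb)); rewrite leqnn.
have ga r : r <= s n -> gam r = alpha r by rewrite /gam => ->.
have gb r : t 0%N <= r -> gam r = beta r.
  rewrite -st /gam le_eqVlt => /predU1P[<-|]; first by rewrite lexx ab st.
  by rewrite ltNge => /negbTE ->.
have piece k : (k < n + m)%N -> ((k < n)%N /\ u k = s k /\ u k.+1 = s k.+1) \/
    exists2 l, (l < m)%N & u k = t l /\ u k.+1 = t l.+1.
  move=> knm; have [kn|nk] := ltnP k n.
    by left; rewrite !ul// ltnW.
  by right; exists (k - n)%N; rewrite ?ltn_subLR// -!uE addnS subnKC.
have la k : (k < n)%N -> forall r, s k < r < s k.+1 -> alpha r = gam r.
  move=> kn r rk; rewrite ga//; have /(_ r) := pc_sub pa kn.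
  by rewrite /= !in_itv/=; case/andP: rk => /ltW-> /ltW-> /(_ isT)/andP[].
have lb l : (l < m)%N -> forall r, t l < r < t l.+1 -> beta r = gam r.
  move=> lm r rl; rewrite gb//; have /(_ r) := pc_sub pb lm.
  by rewrite /= !in_itv/=; case/andP: rl => /ltW-> /ltW-> /(_ isT)/andP[].
split.
- move=> k /piece[[kn [-> ->]]|[l lm [-> ->]]]; first exact: (pc_partition pa).
  exact: (pc_partition pb).
- move=> r; rewrite ul// uE => /andP[sr rt].
  have [rn|nr] := leP r (s n); first by rewrite ga//; apply: (pc_slab pa); rewrite sr.
  by rewrite gb ?st -?st ?(ltW nr)//; apply: (pc_slab pb); rewrite -st (ltW nr).
- rewrite ul// uE.
  have -> : `[s 0%N, t m]%classic = `[s 0%N, s n] `|` `[t 0%N, t m].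
    apply/seteqP; split=> r /=; rewrite !in_itv/=.
      by move=> /andP[-> ->]; have [rn|/ltW nr] := leP r (s n);
        [left|right; rewrite -st nr].
    move=> [/andP[-> rn]/=|/andP[tr ->]]; first by rewrite (le_trans rn)// st.
    by rewrite andbT (le_trans s0n)// st.
  apply: withinU_continuous; [exact: itv_closed|exact: itv_closed| |].
    apply: subspace_eq_continuous (pc_cont pa) => r.
    by rewrite inE/= in_itv/= => /andP[_ /ga]; exact: esym.
  apply: subspace_eq_continuous (pc_cont pb) => r.
  by rewrite inE/= in_itv/= => /andP[/gb]; exact: (fun e _ => esym e).
- move=> k /piece[[kn [-> ->]]|[l lm [-> ->]]].
    exact: smooth_curve_eq (pc_cont_piece pa kn) (la _ kn) (pc_smooth pa kn).
  exact: smooth_curve_eq (pc_cont_piece pb lm) (lb _ lm) (pc_smooth pb lm).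
- move=> k /piece[[kn [-> ->]]|[l lm [-> ->]]].
    by have [?|?] := pc_causal pa kn; [left|right]; apply: (along_eq (la _ kn)).
  by have [?|?] := pc_causal pb lm; [left|right]; apply: (along_eq (lb _ lm)).
Qed.

(** The null distance is the infimum of these lengths, and the infimum of the
    empty set is [0]; statements about existing curves avoid that case. *)
Definition reach p q L := exists n s alpha, [/\ piecewise_causal T h n s alpha,
  alpha (s 0%N) = p, alpha (s n) = q & L = null_length n s alpha].

Lemma reach_refl p : slab p -> reach p p 0.
Proof.
move=> sp; exists 0%N, (fun=> 0), (fun=> p); split=> //; last first.
  by rewrite /null_length big_ord0.
split=> //; apply: continuous_subspaceT => x; exact: cvg_cst.
Qed.

(** The null length is a sum of increments of [t] in absolute value. *)
Lemma reach_time p q L : reach p q L -> `|p.1 - q.1| <= L.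
Proof.
move=> [n [s [alpha [pc <- <- ->]]]]; rewrite /null_length.
elim: n {pc} => [|n IH]; first by rewrite big_ord0 subrr normr0.
rewrite big_ord_recr/= -(subrKA (alpha (s n)).1) (le_trans (ler_normD _ _))//.
by rewrite lerD// distrC.
Qed.

Lemma reach_sym p q L : reach p q L -> reach q p L.
Proof.
move=> [n [s [alpha [pc <- <- ->]]]].
have lineE r : 0 + (- r) *: (-1) = r :> R by rewrite add0r [_ *: _]mulrN1 opprK.
exists n, (fun k => - s (n - k)%N), (fun r => alpha (0 + r *: (-1))); split.
- exact: pc_reverse.
- by rewrite lineE subn0.
- by rewrite lineE subnn.
- rewrite /null_length (reindex_inj rev_ord_inj)/=; apply: eq_bigr => k _.
  by rewrite !lineE distrC -subSn// subSS.
Qed.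

Lemma reach_trans q p r L L' : reach p q L -> reach q r L' -> reach p r (L + L').
Proof.
move=> [n [s [alpha [pa ap aq ->]]]] [m [t [beta [pb bq br ->]]]].
pose c := t 0%N - s n.
have pb' := pc_shift c pb.
have lineE k : c + (t k - c) *: 1 = t k by rewrite [_ *: _]mulr1 addrC subrK.
have st : s n = t 0%N - c by rewrite /c subKr.
have := pc_cat pa pb' st; rewrite lineE bq aq => /(_ erefl).
set u := (fun k => if _ then _ else _); set gam := (fun r => if _ then _ else _).
have s0n : s 0%N <= s n by apply: (partition_le (pc_partition pa)); rewrite leqnn.
have uE k : u (n + k)%N = t k - c.
  rewrite /u; case: ifPn => [|_]; last by rewrite addKn.
  by rewrite -{2}(addn0 n) leq_add2l leqn0 => /eqP ->; rewrite addn0.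
have ul k : (k <= n)%N -> u k = s k by rewrite /u => ->.
have gl k : (k <= n)%N -> gam (u k) = alpha (s k).
  move=> kn; rewrite ul// /gam ifT//; apply: (partition_le (pc_partition pa)).
  by rewrite kn/=.
have gr k : (k <= m)%N -> gam (u (n + k)%N) = beta (t k).
  move=> km; rewrite uE /gam; case: ifPn => [le|]; last by rewrite lineE.
  have tE : t k = t 0%N.
    apply: le_anti; apply/andP; split; first by move: le; rewrite st lerD2r.
    exact: (partition_le (pc_partition pb)).
  by rewrite tE -st aq bq.
move=> pc; exists (n + m)%N, u, gam; split=> //.
- by rewrite gl.
- by rewrite gr.
- rewrite /null_length big_split_ord/=; congr (_ + _); apply: eq_bigr => k _.
    by rewrite !gl// ltnW.
  by rewrite -addnS !gr// ltnW.
Qed.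

Lemma null_dist_le p q L : reach p q L -> null_dist T h p q <= L.
Proof.
move=> r; apply: ge_inf => //; exists 0 => ? /reach_time.
exact: (le_trans (normr_ge0 _)).
Qed.

Lemma null_dist_time p q L : reach p q L -> `|p.1 - q.1| <= null_dist T h p q.
Proof.
move=> r; apply: lb_le_inf; first by exists L.
by move=> ? /reach_time.
Qed.

Lemma null_dist_approx p q L e : reach p q L -> 0 < e ->
  exists2 L', reach p q L' & L' < null_dist T h p q + e.
Proof.
move=> r e0.
have hi : has_inf [set L | reach p q L].
  by split; [exists L|exists 0 => ? /reach_time; exact: (le_trans (normr_ge0 _))].
by have [L' rL' lt] := inf_adherent e0 hi; exists L'.
Qed.

End one_metric.
End operations.

(** * Comparison of spatial metrics and causal segments *)

Section local_estimates.
Variables (R : realType) (E : normedModType R) (M : topologicalType).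
Variables (A : charts E M) (T : R).
Hypothesis atlasA : smooth_atlas A.
Local Notation A' := (time_charts A).
Local Notation point := (R * M)%type.
Local Notation vector := (R * E)%type.
Local Notation slab := (@slab R M T).

(** Enlarging the spatial metric shrinks the causal cones, so there are fewer
    causal curves. *)
Lemma reach_mono (h k : tensor2 A') (hbar kbar : R -> tensor2 A) :
  cosmological T h -> extends_to_closed_slab T h hbar ->
  cosmological T k -> extends_to_closed_slab T k kbar ->
  (forall t, 0 < t < T -> tensor_le (hbar t) (kbar t)) ->
  forall p q L, reach T k p q L -> reach T h p q L.
Proof.
move=> ch eh ck ek hk p q L [n [s [alpha [pc ap aq ->]]]].
exists n, s, alpha; split=> //.
split; [exact: pc_partition pc|exact: pc_slab pc|exact: pc_cont pc|exact: pc_smooth pc|].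
move=> l ln; have sl (r : R) := pc_slab_piece pc ln (r := r).
have [F|P] := pc_causal pc ln; [left|right] => r i rl dr; have sr := sl r rl.
  have /(future_directedE ck ek _ sr dr)[v0 vk] := F r i rl dr.
  apply/(future_directedE ch eh _ sr dr); split=> //; apply: le_trans vk.
  exact: hk.
have /(past_directedE ck ek _ sr dr)[v0 vk] := P r i rl dr.
apply/(past_directedE ch eh _ sr dr); split=> //; apply: le_trans vk.
exact: hk.
Qed.

Section segment.
Variables (h : tensor2 A') (hbar : R -> tensor2 A) (k : tensor2 A).
Hypothesis cosmo : cosmological T h.
Hypothesis ext : extends_to_closed_slab T h hbar.
Hypothesis hk : forall t, 0 < t < T -> tensor_le (hbar t) k.
Hypothesis symk : sym2_on setT k.

(** The velocity in a chart [j] is [(t' - t, d(trans i j)(z - y))].  Bounding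
    [h_t] by [k] in the chart [j], and only then changing charts for the tensor
    [k] on [M], avoids differentiating the transition maps of the product with
    the time axis. *)
Lemma reach_segment (i : idx A) (t t' : R) (y z : E) :
  0 < t < T -> 0 < t' < T -> t != t' ->
  (forall r : R, 0 <= r <= 1 -> (coord i @` dom i) (y + r *: (z - y))) ->
  (forall r : R, 0 <= r <= 1 ->
     k i (param i (y + r *: (z - y))) (z - y) (z - y) <= (t' - t) ^+ 2) ->
  reach T h (t, param i y) (t', param i z) `|t' - t|.
Proof.
move=> tT t'T tt' yzi kyz.
pose alpha r : point := (t + r *: (t' - t), param i (y + r *: (z - y))).
have oo (r : R) : 0 < r < 1 -> 0 <= r <= 1 by move=> /andP[/ltW-> /ltW->].
have sl (r : R) : 0 <= r <= 1 -> slab (alpha r).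
  move=> /andP[r0 r1]; rewrite /slab /alpha /= -[r *: _]/(r * _).
  by case/andP: tT => t0 tT; case/andP: t'T => t'0 t'T; apply/andP; split; nra.
have ca (r : R) : 0 <= r <= 1 -> {for r, continuous alpha}.
  move=> r01.
  have c1 : {for r, continuous (fun r : R => t + r *: (t' - t))} by exact: continuous_line.
  have c2 : {for r, continuous (param i \o (fun r : R => y + r *: (z - y)))}.
    apply: continuous_comp; first exact: continuous_line.
    by apply: (param_cont atlasA); exact: yzi.
  exact: cvg_pair c1 c2.
have cw : {within `[0, 1], continuous alpha}.
  apply/subspace_continuousP => r; rewrite /= in_itv/= => /ca cr.
  by apply: cvg_trans cr; apply: cvg_app; exact: cvg_within.
have ov (l : idx A) (r : R) : 0 <= r <= 1 -> dom l (param i (y + r *: (z - y))) ->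
    (coord i @` (dom i `&` dom l)) (y + r *: (z - y)).
  by move=> /yzi[x dx <-]; rewrite (coordK atlasA)// => dlx; exists x.
pose s (l : nat) : R := l%:R.
have lt1 l : (l < 1)%N -> l = 0%N by case: l.
have pc : piecewise_causal T h 1 s alpha.
  split=> //.
  - by move=> l /lt1->; exact: ltr01.
  - move=> l /lt1 -> j.
    rewrite (_ : s 0%N = 0)// (_ : s 1%N = 1)//.
    have oU : open (`]0, 1[ `&` alpha @^-1` dom (j : idx A')).
      by apply: open_itv_preimage cw _; exact: open_time_dom.
    apply: (smooth_on_pair oU).
      have S := smooth_on_line t (t' - t) openT (@smooth_on_id _ _ setT).
      exact: smooth_on_sub S.
    have S := smooth_on_line y (z - y) (open_overlap atlasA i j)
      (trans_smooth atlasA i j).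
    apply: smooth_on_sub S => r /= [+ dr]; rewrite in_itv/= => /oo r01.
    exact: ov.
  - move=> l /lt1 ->; rewrite /along (_ : s 0%N = 0)// (_ : s 1%N = 1)//.
    have vE (r : R) (j : idx A') : 0 < r < 1 -> dom j (alpha r) ->
       velocity alpha j r = (t' - t, 'd (trans (i : idx A) j) (y + r *: (z - y)) (z - y)).
      move=> /oo r01 dr.
      have d1 := is_diff_line t (t' - t) r.
      have d2 := is_diff_line y (z - y) r.
      have [d3 _] := trans_smooth atlasA i j 1%N.
      have {}d3 := d3 _ (ov _ _ r01 dr).
      have d1' := @ex_diff _ _ _ _ _ _ _ d1.
      have d2' := @ex_diff _ _ _ _ _ _ _ d2.
      have d23 := differentiable_comp d2' d3.
      have -> : velocity alpha j r = ((fun r => (t + r *: (t' - t),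
          (trans (i : idx A) j \o (fun r => y + r *: (z - y))) r))^`() r)%classic by [].
      rewrite derive1E'; last exact: (differentiable_pair d1' d23).
      rewrite (diff_pair d1' d23) (diff_comp d2' d3)/=.
      rewrite (@diff_val _ _ _ _ _ _ _ d1) (@diff_val _ _ _ _ _ _ _ d2).
      by rewrite !scale1r.
    have kE (r : R) (j : idx A') : 0 < r < 1 -> dom j (alpha r) ->
        hbar (alpha r).1 j (alpha r).2 (velocity alpha j r).2 (velocity alpha j r).2
          <= (velocity alpha j r).1 ^+ 2.
      move=> r01 dr; rewrite vE//=; have kr := kyz _ (oo _ r01).
      apply: (le_trans _ kr).
      apply: (@le_trans _ _ (k j (alpha r).2 ('d (trans (i : idx A) j) (y + r *: (z - y)) (z - y))
         ('d (trans (i : idx A) j) (y + r *: (z - y)) (z - y)))).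
        by apply: hk => //; exact: sl (oo _ r01).
      have [x dx xE] := yzi _ (oo _ r01).
      have ax : (alpha r).2 = x by rewrite /alpha/= -xE (coordK atlasA).
      rewrite ax -xE (coordK atlasA)//.
      have dj : dom (j : idx A) x by move: dr; rewrite /= -xE (coordK atlasA).
      by rewrite [leRHS](sym2_change symk (j := j)).
    have [lt|lt|eq] := ltgtP t t'; [left|right|by rewrite eq eqxx in tt'] => r j r01 dr.
      apply/(future_directedE cosmo ext _ (sl _ (oo _ r01)) dr); split; last exact: kE.
      by rewrite vE//= subr_gt0.
    apply/(past_directedE cosmo ext _ (sl _ (oo _ r01)) dr); split; last exact: kE.
    by rewrite vE//= subr_lt0.
exists 1%N, s, alpha; split=> //.
- by rewrite /alpha !scale0r !addr0.
- by rewrite /alpha !scale1r (addrC t) (addrC y) !subrK.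
- by rewrite /null_length big_ord1 /alpha/= !scale1r !scale0r addr0 [t + _]addrC subrK.
Qed.

Lemma reach_vertical x t t' : 0 < t < T -> 0 < t' < T ->
  reach T h (t, x) (t', x) `|t' - t|.
Proof.
move=> tT t'T; have [->|tt'] := eqVneq t t'.
  by rewrite subrr normr0; exact: reach_refl.
have [i dx] := dom_cover atlasA x.
rewrite -(coordK atlasA dx); apply: reach_segment => //.
  by move=> r _; rewrite subrr scaler0 addr0; exists x.
move=> r _; rewrite subrr scaler0 addr0.
rewrite (coordK atlasA)// (scalar0 (sym2_linear symk 0 I dx)).
exact: sqr_ge0.
Qed.
End segment.

End local_estimates.

(** * Symmetric bilinear forms on row vectors *)

Section forms.
Variables (R : realType) (n : nat).
Local Notation E := 'rV[R]_n.+1.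
Local Notation e_ a := (delta_mx 0 a : E).
Implicit Types b : E -> E -> R.

Lemma coord_le_norm (u : E) a : `|u 0 a| <= `|u|.
Proof.
rewrite [leRHS]/Num.Def.normr/= mx_normrE.
exact: (le_bigmax _ (fun i : 'I_1 * 'I_n.+1 => `|u i.1 i.2|) (0, a)).
Qed.

Lemma norm_le_coord (u : E) (c : R) : 0 <= c -> (forall a, `|u 0 a| <= c) -> `|u| <= c.
Proof.
move=> c0 uc; rewrite [leLHS]/Num.Def.normr/= mx_normrE.
by apply: bigmax_le => // -[i j] _ /=; rewrite ord1.
Qed.

Definition sym_form b := (forall u, scalar (b u)) /\ forall u v, b u v = b v u.

Lemma form_sumr b u (c : 'I_n.+1 -> R) : scalar (b u) ->
  b u (\sum_a c a *: e_ a) = \sum_a c a * b u (e_ a).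
Proof.
move=> lb; elim/big_rec2 : _ => [|a x y _ <-]; first exact: scalar0.
by rewrite lb.
Qed.

Lemma form_expand b u : sym_form b ->
  b u u = \sum_a \sum_c u 0 a * u 0 c * b (e_ a) (e_ c).
Proof.
move=> [lb sb]; rewrite {1 2}(row_sum_delta u) form_sumr//.
apply: eq_bigr => a _; rewrite sb form_sumr// mulr_sumr.
by apply: eq_bigr => c _; rewrite mulrA sb.
Qed.

(** Closeness of the finitely many matrix coefficients controls the quadratic
    forms on all vectors at once. *)
Lemma form_diff_le b b' (d : R) u : sym_form b -> sym_form b' ->
  (forall a c, `|b (e_ a) (e_ c) - b' (e_ a) (e_ c)| <= d) ->
  `|b u u - b' u u| <= (n.+1 ^ 2)%:R * d * `|u| ^+ 2.
Proof.
move=> fb fb' bd; rewrite !form_expand// -sumrB.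
apply: (@le_trans _ _ (\sum_(a < n.+1) \sum_(c < n.+1) d * `|u| ^+ 2)); last first.
  by rewrite sumr_const card_ord sumr_const card_ord -mulrnA mulnn -[leLHS]mulr_natl mulrA.
rewrite (le_trans (ler_norm_sum _ _ _))//; apply: ler_sum => a _.
rewrite -sumrB (le_trans (ler_norm_sum _ _ _))//; apply: ler_sum => c _.
rewrite -mulrBr normrM mulrC ler_pM// normrM expr2.
by rewrite ler_pM// coord_le_norm.
Qed.

Lemma sym_form0 : sym_form (fun _ _ => 0).
Proof. by split=> // u a v w; rewrite mulr0 addr0. Qed.

Lemma form_le b (d : R) u : sym_form b ->
  (forall a c, `|b (e_ a) (e_ c)| <= d) ->
  `|b u u| <= (n.+1 ^ 2)%:R * d * `|u| ^+ 2.
Proof.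
move=> fb bd; rewrite -[b u u]subr0.
by apply: (form_diff_le _ fb sym_form0) => a c; rewrite subr0.
Qed.

Lemma form_continuous b : sym_form b -> continuous (fun u : E => b u u).
Proof.
move=> fb u.
have -> : (fun u => b u u) = (fun u => \sum_a \sum_c u 0 a * u 0 c * b (e_ a) (e_ c)).
  by apply/funext => v; rewrite form_expand.
have nF : Filter (nbhs u) := nbhs_filter u.
apply: (@cvg_big R _ +%R 0 xpredT add_continuous E (nbhs u) _ _ _ nF) => a _.
apply: (@cvg_big R _ +%R 0 xpredT add_continuous E (nbhs u) _ _ _ nF) => c _.
by apply: cvgM; [apply: cvgM; exact: coord_continuous|exact: cvg_cst].
Qed.


(** The minimum on the unit sphere, which is compact, is positive; the general
    case follows by homogeneity. *)
Lemma posdef_form_ge b : sym_form b -> (forall u, u != 0 -> 0 < b u u) ->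
  exists2 c : R, 0 < c & forall u, c * `|u| ^+ 2 <= b u u.
Proof.
move=> fb pb.
pose S : set E := [set u | `|u| = 1].
have S0 : S !=set0.
  exists (const_mx 1); apply: le_anti; apply/andP; split.
    by apply: norm_le_coord => // a; rewrite mxE normr1.
  by have := coord_le_norm (const_mx 1 : E) 0; rewrite mxE normr1.
have cS : compact S.
  apply: bounded_closed_compact.
    by exists 1; split=> // x x1 u /= ->; exact: ltW.
  apply: (@closed_comp _ _ (fun u : E => `|u|) [set (1 : R)]).
    by move=> u _; exact: norm_continuous.
  exact: closed_eq.
have [u uS umin] := EVT_min_rV S0 cS (continuous_subspaceT (form_continuous fb)).
have u1 : `|u| = 1 by move: uS; rewrite inE.
exists (b u u); first by apply: pb; rewrite -normr_gt0 u1.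
move=> v; have [->|v0] := eqVneq v 0.
  by rewrite normr0 expr0n mulr0 (scalar0 (fb.1 0)).
have nv : 0 < `|v| by rewrite normr_gt0.
have : b u u <= b (`|v|^-1 *: v) (`|v|^-1 *: v).
  by apply: umin; rewrite inE /S /= normrZ normfV normr_id mulVf// gt_eqF.
rewrite (scalarZ (fb.1 _)) fb.2 (scalarZ (fb.1 _)) mulrA -ler_pdivrMl ?mulr_gt0 ?invr_gt0//.
by rewrite invfM invrK -expr2 mulrC.
Qed.

End forms.

(** * Short causal curves between nearby points *)

Section upper.
Variables (R : realType) (n : nat) (M : topologicalType).
Local Notation E := 'rV[R]_n.+1.
Local Notation e_ a := (delta_mx 0 a : E).
Variables (A : charts E M) (T : R).
Hypothesis atlasA : smooth_atlas A.
Hypothesis T0 : 0 < T.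
Local Notation A' := (time_charts A).
Local Notation slab := (@slab R M T).
Variable k : tensor2 A.
Hypothesis riemk : riemannian k.

Lemma sym2_form i x : dom i x -> sym_form (k i x).
Proof.
case: riemk => sk _ _ dx; split=> [u|u v]; first exact: (sym2_linear sk).
exact: (sym2_sym sk).
Qed.

(** The coefficients of [k] in a chart are continuous, hence bounded near the
    given point. *)
Lemma riemannian_locally_le (i : idx A) x : dom i x ->
  exists2 C : R, 0 < C & \forall y \near coord i x,
    (coord i @` dom i) y /\ forall u, k i (param i y) u u <= C ^+ 2 * `|u| ^+ 2.
Proof.
move=> dx; have [_ smk _] := riemk.
pose m a c := k i x (e_ a) (e_ c).
(* A bound for all coefficients at [x], with some room. *)
pose K := \sum_a \sum_c `|m a c| + 1.
have mK a c : `|m a c| < K.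
  rewrite ltr_pwDr// (bigD1 a)//= (bigD1 c)//=.
  rewrite -addrA lerDl addr_ge0// ?sumr_ge0// => j _.
  by rewrite sumr_ge0.
have K0 : 0 < K by apply: le_lt_trans (mK 0 0); exact: normr_ge0.
have ix : (coord i @` dom i) (coord i x) by exists x.
have near_m a c : \forall y \near coord i x, `|k i (param i y) (e_ a) (e_ c)| < K.
  have ck := smk i (e_ a) (e_ c) 0%N (coord i x).
  have {}ck : {for coord i x, continuous (fun y => k i (param i y) (e_ a) (e_ c))}.
    by apply: ck; exists x.
  apply: (@cvgr_norm_lt _ R^o _ _ _ _ _ ck).
  by rewrite (coordK atlasA)//; exact: mK.
have near_mm : \forall y \near coord i x, forall a c,
    `|k i (param i y) (e_ a) (e_ c)| < K.
  have near_a a : \forall y \near coord i x, forall c,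
      `|k i (param i y) (e_ a) (e_ c)| < K by exact: filter_forall (near_m a).
  by exact: filter_forall near_a.
pose D : R := (n.+1 ^ 2)%:R * K.
have D0 : 0 < D by rewrite mulr_gt0.
(* [D <= (D + 1) ^ 2], so [D + 1] serves as a constant to be squared. *)
exists (D + 1); first by rewrite addr_gt0.
near=> y.
have iy : (coord i @` dom i) y.
  near: y; apply: open_nbhs_nbhs; split=> //; exact: image_open.
split=> // u.
have [dy _] := paramK atlasA iy.
have Ky a c : `|k i (param i y) (e_ a) (e_ c)| <= K.
  by apply: ltW; move: a c; near: y.
rewrite (le_trans (ler_norm _))// (le_trans (form_le u (sym2_form dy) Ky))//.
rewrite ler_wpM2r ?sqr_ge0// -/D expr2; nra.
Unshelve. all: by end_near. Qed.

(** The upper estimate.  The neighbourhood depends on [k] only and not on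
    [h], so it is the same for all metrics of the sequence. *)
Lemma reach_locally (x : M) (e : R) : 0 < e ->
  exists (d : R) (U : set M), [/\ 0 < d, nbhs x U &
  forall y z, U y -> U z -> forall (h : tensor2 A') (hbar : R -> tensor2 A),
  cosmological T h -> extends_to_closed_slab T h hbar ->
  (forall t, 0 < t < T -> tensor_le (hbar t) k) ->
  forall t t', 0 < t < T -> 0 < t' < T -> `|t - t'| < d ->
  exists2 L, L <= e & reach T h (t, y) (t', z) L].
Proof.
move=> e0.
have [i dx] := dom_cover atlasA x.
have [C C0] := riemannian_locally_le dx; set y0 := coord i x.
move=> /nbhs_ballP[r /= r0 rC].
(* The time lapse [l] below is then at most [e / 4], which bounds the null
   length, and at most [T / 4], which leaves room to go up or down. *)
pose rho := Num.min r (Num.min (e / (8 * C)) (T / (8 * C))).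
have rho0 : 0 < rho by rewrite !lt_min r0 !divr_gt0// mulr_gt0.
have rho_r : rho <= r by rewrite ge_min lexx.
pose l := 2 * C * rho.
have l0 : 0 < l by rewrite !mulr_gt0.
have rho_le (c : R) : rho <= c / (8 * C) -> l <= c / 4.
  move=> rc; rewrite /l -ler_pdivlMl ?mulr_gt0//.
  suff -> : (2 * C)^-1 * (c / 4) = c / (8 * C) by [].
  by field; rewrite gt_eqF.
have le4 : l <= e / 4 by apply: rho_le; rewrite /rho !ge_min lexx orbT.
have lT4 : l <= T / 4 by apply: rho_le; rewrite /rho !ge_min lexx !orbT.
exists (e / 2), [set y | dom i y /\ ball y0 rho (coord i y)].
split; first by rewrite divr_gt0.
  apply: filterI; first by apply: open_nbhs_nbhs; split=> //; exact: dom_open.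
  by apply: (coord_cont atlasA dx); exact: nbhsx_ballx.
move=> y z /= [dy By] [dz Bz] h hbar ch eh hk t t' tT t'T tt'.
rewrite -(coordK atlasA dy) -(coordK atlasA dz).
move: (coord i y) (coord i z) By Bz => {y z dy dz} y z.
rewrite -!ball_normE /ball_/= => By Bz.
have seg (s : R) : 0 <= s <= 1 -> ball y0 r (y + s *: (z - y)).
  move=> /andP[s0 s1]; rewrite -ball_normE /ball_/=.
  have -> : y0 - (y + s *: (z - y)) = (1 - s) *: (y0 - y) + s *: (y0 - z).
    by apply/rowP => j; rewrite !mxE; ring.
  apply: le_lt_trans (ler_normD _ _) _; rewrite !normrZ !ger0_norm ?subr_ge0//.
  pose m := Num.max `|y0 - y| `|y0 - z|.
  have mr : m < r by rewrite gt_max !(lt_le_trans _ rho_r).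
  have ym : `|y0 - y| <= m by rewrite le_max lexx.
  have zm : `|y0 - z| <= m by rewrite le_max lexx orbT.
  by apply: le_lt_trans mr; nra.
have yz : `|z - y| <= 2 * rho.
  rewrite -(subrKA y0) (le_trans (ler_normD _ _))// distrC.
  by rewrite distrC (distrC z); lra.
(* Go up if there is room below [T], down otherwise. *)
have [t1 [t1T tt1]] : exists t1, 0 < t1 < T /\ `|t1 - t| = l.
  case/andP: tT => t0 tT; have [ltT|leT] := ltP (t + l) T.
    by exists (t + l); rewrite addrAC subrr add0r gtr0_norm//; split=> //; apply/andP; split; lra.
  exists (t - l); rewrite addrAC subrr add0r normrN gtr0_norm//; split=> //.
  by apply/andP; split; lra.
(* The segment has constant lapse [l >= C * `|z - y|] even if [y = z], so
   that it is never degenerate. *)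
have R1 : reach T h (t, param i y) (t1, param i z) l.
  rewrite -tt1; apply: (reach_segment atlasA ch eh hk) => //; first by case: riemk.
  - by apply/eqP => tt; move: tt1 l0; rewrite tt subrr normr0 => <-; rewrite ltxx.
  - by move=> s /seg /rC[].
  - move=> s /seg /rC[_ /(_ (z - y))] => /le_trans; apply.
    rewrite -[leRHS]real_normK ?num_real// tt1 -exprMn.
    rewrite ler_sqr ?nnegrE ?mulr_ge0 ?(ltW C0) ?(ltW l0) ?(ltW rho0)//.
    by rewrite /l; nra.
have R2 := reach_vertical atlasA ch eh hk (let: And3 sk _ _ := riemk in sk) (param i z) t1T t'T.
exists (l + `|t' - t1|); last exact: reach_trans R1 R2.
have : `|t' - t1| <= `|t - t'| + l.
  have -> : t' - t1 = (t' - t) + (t - t1) by ring.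
  by rewrite -tt1 (le_trans (ler_normD _ _))// (distrC t') (distrC t t1).
by move=> h1; lra.
Qed.
End upper.

(** * A mean value inequality and induction on intervals *)

Section calculus.
Variable R : realType.

Lemma derive1_comp_linear (V W : normedModType R) (f : R -> V)
    (l : {linear V -> W}) (r : R) : continuous l -> differentiable f r ->
  differentiable (l \o f) r /\ (l \o f)^`()%classic r = l (f^`()%classic r).
Proof.
move=> cl df.
have dl x : differentiable l x by exact: linear_differentiable.
have dlf : differentiable (l \o f) r by exact: differentiable_comp.
by split=> //; rewrite derive1E'// diff_comp// derive1E'//= diff_lin.
Qed.

(** The supremum of the points up to which [P] holds belongs to that set, by
    the limit step, and cannot be smaller than [b], by the extension step. *)
Lemma itv_induction (a b : R) (P : R -> Prop) : a <= b -> P a ->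
  (forall s, a <= s < b -> (forall r, a <= r <= s -> P r) ->
    exists2 s', s < s' & forall r, s < r <= s' -> r <= b -> P r) ->
  (forall s, a < s <= b -> (forall r, a <= r < s -> P r) -> P s) ->
  forall s, a <= s <= b -> P s.
Proof.
move=> ab Pa Pstep Plim.
pose Q := [set s | a <= s <= b /\ forall r, a <= r <= s -> P r].
have Qa : Q a.
  split; first by rewrite lexx ab.
  by move=> r /le_anti <-.
have hQ : has_sup Q.
  by split; [exists a|exists b => s [/andP[]]].
pose m := sup Q.
have am : a <= m by apply: sup_upper_bound.
have mb : m <= b by apply: ge_sup; [exists a|move=> s [/andP[]]].
have Pm r : a <= r < m -> P r.
  move=> /andP[ar rm]; have [s [_ Ps] rs] := sup_gt (proj1 hQ) rm.
  by apply: Ps; rewrite ar ltW.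
have Qm : Q m.
  split; first by rewrite am mb.
  move=> r /andP[ar]; rewrite le_eqVlt => /predU1P[->|rm]; last by apply: Pm; rewrite ar.
  move: am; rewrite le_eqVlt => /predU1P[<-//|am].
  by apply: Plim => //; rewrite am.
have mE : m = b.
  apply/eqP; rewrite eq_le mb leNgt; apply/negP => mltb.
  have [|s' ms' Ps'] := Pstep m _ Qm.2; first by rewrite am mltb.
  pose s'' := Num.min s' b.
  have ms'' : m < s'' by rewrite lt_min ms' mltb.
  have : Q s''.
    split; first by rewrite ge_min lexx orbT andbT (le_trans am)// ltW.
    move=> r /andP[ar]; rewrite le_min => /andP[rs' rb].
    have [rm|mr] := leP r m; first by apply: Qm.2; rewrite ar.
    by apply: Ps' => //; rewrite mr.
  by move=> /(sup_upper_bound hQ); rewrite leNgt ms''.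
by move: Qm.2; rewrite mE.
Qed.

(** For each coordinate [x_j] and each [c] with [|c| <= 1], the function
    [K t - c x_j] has a nonnegative derivative.  The norm on row vectors being
    the supremum norm, [c = 1] and [c = -1] bound it, and [c = 0] shows that
    the bound is nonnegative. *)
Lemma mean_value_cone n (F : R -> R * 'rV[R]_n.+1) (K a b : R) : a <= b ->
  {within `[a, b], continuous F} ->
  (forall s, a < s < b -> differentiable F s) ->
  (forall s, a < s < b -> `|(F^`()%classic s).2| <= K * (F^`()%classic s).1) ->
  `|(F b).2 - (F a).2| <= K * ((F b).1 - (F a).1).
Proof.
move=> ab cF dF dF'.
have H (c : R) (j : 'I_n.+1) : `|c| <= 1 ->
    c * ((F b).2 0 j - (F a).2 0 j) <= K * ((F b).1 - (F a).1).
  move=> c1.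
  pose l (z : R * 'rV[R]_n.+1) : R := K * z.1 - c * z.2 0 j.
  have ll : linear l.
    move=> x u v; rewrite /l /= !mxE /=; rewrite -[x *: u.1]/(x * u.1) -[x *: (_ - _)]/(x * _).
    by ring.
  pose L : {linear (R * 'rV[R]_n.+1)%type -> R} := HB.pack l (GRing.isLinear.Build _ _ _ _ l ll).
  have cL : continuous L.
    move=> z; apply: cvgB; apply: cvgM; [exact: cvg_cst|exact: cvg_fst|exact: cvg_cst|].
    by apply: (@cvg_comp _ _ _ snd (fun y : 'rV[R]_n.+1 => y 0 j)); [exact: cvg_snd|exact: coord_continuous].
  have G s : a < s < b -> differentiable (L \o F) s /\
      (L \o F)^`()%classic s = L (F^`()%classic s).
    by move=> sab; apply: derive1_comp_linear => //; exact: dF.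
  have mono : (L \o F) a <= (L \o F) b.
    apply: (@ger0_derive1_le_cc R (L \o F) a b) => //.
    - by move=> s; rewrite in_itv/= => /G[/derivable1_diffP].
    - move=> s; rewrite in_itv/= => sab; rewrite (G _ sab).2 /= /l subr_ge0.
      apply: le_trans (dF' _ sab); rewrite (le_trans (ler_norm _))// normrM.
      by rewrite (le_trans (ler_piMl _ c1))// coord_le_norm.
    - apply/subspace_continuousP => s sab; move/subspace_continuousP : cF => /(_ s sab) cF.
      by apply: cvg_comp cF (cL _).
    - by rewrite in_itv/= lexx ab.
    - by rewrite in_itv/= lexx ab.
  by move: mono; rewrite /= /l; lra.
apply: norm_le_coord.
  by have := H 0 0; rewrite normr0 mul0r ler01; exact.
move=> j; rewrite !mxE ler_norml.
have := H 1 j; rewrite normr1 lexx mul1r => /(_ isT) -> /=.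
have := H (-1) j; rewrite normrN1 lexx mulN1r => /(_ isT) H1.
by rewrite andbT lerNl.
Qed.
End calculus.

(** * Positivity of the spatial metric up to the boundary *)

Section lower.
Variables (R : realType) (n : nat) (M : topologicalType).
Local Notation E := 'rV[R]_n.+1.
Local Notation e_ a := (delta_mx 0 a : E).
Variables (A : charts E M) (T : R).
Local Notation A' := (time_charts A).
Local Notation point := (R * M)%type.
Local Notation slab := (@slab R M T).
Local Notation cslab := (@closed_slab R M T).
Variables (h : tensor2 A') (hbar : R -> tensor2 A).
Hypothesis cosmo : cosmological T h.
Hypothesis ext : extends_to_closed_slab T h hbar.

Lemma slab_hbar_form i (p : point) : slab p -> dom (i : idx A) p.2 ->
  sym_form (hbar p.1 i p.2).
Proof.
move=> sp dp; have sy := cosmo_sym2 cosmo.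
split=> [u|u v]; last by rewrite !(ext_restr ext)// (sym2_sym sy).
move=> a v w; rewrite !(ext_restr ext)//.
have -> : (0, a *: v + w) = a *: (0, v) + (0, w) :> (R * E)%type.
  rewrite [RHS]surjective_pairing; congr (_, _) => /=.
  by rewrite scaler0 addr0.
by rewrite (sym2_linear sy).
Qed.

(** Suppose [h(w, w) <= 0] and let [e] be the timelike vector given by the
    signature.  Its time component is nonzero, since otherwise [del_t] would be
    orthogonal to [e] without being spacelike.  The combination [z] of [del_t]
    and [w] which is orthogonal to [e] is then nonzero and not spacelike, a
    contradiction. *)
Lemma slab_hbar_posdef i (p : point) w : slab p -> dom (i : idx A) p.2 ->
  w != 0 -> 0 < hbar p.1 i p.2 w w.
Proof.
move=> sp dp w0; have sy := cosmo_sym2 cosmo.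
have fp := slab_hbar_form sp dp.
have [e [ee eP]] := cosmo_lorentzian cosmo (i := i) sp dp.
have dt v : h i p v (@del_t R E) = 0 by exact: (del_t_radical cosmo).
have e1 : e.1 != 0.
  apply/eqP => e1.
  have := eP (@del_t R E); rewrite /metric_of !dt /= e1 mul0r oppr0 addr0 mul1r addr0.
  have -> : (@del_t R E) != 0.
    by apply/eqP => /(congr1 fst)/= /eqP; rewrite oner_eq0.
  by move=> /(_ isT erefl); rewrite ltr0N1.
rewrite ltNge; apply/negP => hw.
(* The vector of the plane spanned by [del_t] and [w] orthogonal to [e]. *)
pose z : R * E := h i p e (0, w) *: (@del_t R E) + e.1 *: (0, w).
have z1 : z.1 = h i p e (0, w).
  by rewrite /z /= scaler0 addr0 [_ *: _]mulr1.
have z2 : z.2 = e.1 *: w by rewrite /z /= scaler0 add0r.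
have z0 : z != 0.
  apply/eqP => /(congr1 snd) /eqP; rewrite z2 scaler_eq0 (negbTE e1).
  exact/negP.
have ez : metric_of h i p e z = 0.
  rewrite /metric_of z1 /z (sym2_linear sy)//= dt mulr0 add0r.
  by rewrite (scalarZ (sym2_linear sy _ sp dp)) addrC subrr.
have := eP z z0 ez; rewrite (metric_ofE cosmo ext)// z2.
rewrite (scalarZ (fp.1 _)) fp.2 (scalarZ (fp.1 _)).
rewrite ltNge => /negP; apply.
have : e.1 * (e.1 * hbar p.1 i p.2 w w) <= 0.
  by rewrite mulrA -expr2 pmulr_rle0// exprn_even_gt0.
have := sqr_ge0 z.1.
by move=> h1 h2; lra.
Qed.

Lemma hbar_form i (p : point) : cslab p -> dom (i : idx A) p.2 ->
  sym_form (hbar p.1 i p.2) /\ forall u, u != 0 -> 0 < hbar p.1 i p.2 u u.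
Proof.
move=> /andP[p0 pT] dp.
have C0 (k : tensor2 A) : C0_riemannian k ->
    sym_form (k i p.2) /\ forall u, u != 0 -> 0 < k i p.2 u u.
  move=> [sk _ pk]; split; last by move=> u; exact: pk.
  by split=> [u|u v]; [exact: (sym2_linear sk)|exact: (sym2_sym sk)].
move: p0; rewrite le_eqVlt => /predU1P[<-|p0]; first by apply: C0; exact: ext_riem0 ext.
move: pT; rewrite le_eqVlt => /predU1P[->|pT]; first by apply: C0; exact: ext_riemT ext.
have sp : slab p by rewrite /slab /= p0.
split; first exact: slab_hbar_form.
by move=> u; exact: slab_hbar_posdef.
Qed.

(** At [p] itself positivity holds even on the boundary of the slab, and the
    coefficients are continuous up to the boundary, so the bound survives in a
    neighbourhood with half the constant. *)
Lemma hbar_locally_ge i (p : point) : cslab p -> dom (i : idx A) p.2 ->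
  exists2 c : R, 0 < c & \forall q \near p, slab q -> dom i q.2 ->
    forall u, c * `|u| ^+ 2 <= hbar q.1 i q.2 u u.
Proof.
move=> cp dp; have [fp pp] := hbar_form cp dp.
have [c c0 cP] := posdef_form_ge fp pp.
pose d := c / 2 / (n.+1 ^ 2)%:R.
have d0 : 0 < d by rewrite !divr_gt0.
exists (c / 2); first by rewrite divr_gt0.
have near1 a b : \forall q \near p, 0 <= q.1 <= T /\ dom i q.2 ->
    `|hbar p.1 i p.2 (e_ a) (e_ b) - hbar q.1 i q.2 (e_ a) (e_ b)| <= d.
  have ec : {within [set p : point | 0 <= p.1 <= T /\ dom i p.2],
      continuous (fun p => hbar p.1 i p.2 (e_ a) (e_ b))} by exact: (ext_cont ext).
  move/subspace_continuousP : ec => /(_ p (conj cp dp)).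
  by move=> /cvgrPdist_le/(_ _ d0).
have near2 : \forall q \near p, forall a b, 0 <= q.1 <= T /\ dom i q.2 ->
    `|hbar p.1 i p.2 (e_ a) (e_ b) - hbar q.1 i q.2 (e_ a) (e_ b)| <= d.
  have nearb a : \forall q \near p, forall b, 0 <= q.1 <= T /\ dom i q.2 ->
      `|hbar p.1 i p.2 (e_ a) (e_ b) - hbar q.1 i q.2 (e_ a) (e_ b)| <= d.
    exact: filter_forall (near1 a).
  exact: filter_forall nearb.
apply: filterS near2 => q near2 sq dq u.
have cq : cslab q by case/andP: sq => /ltW q0 /ltW qT; rewrite /closed_slab /= q0.
have [fq _] := hbar_form cq dq.
have := form_diff_le u fp fq (fun a b => near2 a b (conj cq dq)).
have -> : (n.+1 ^ 2)%:R * d = c / 2.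
  by rewrite /d mulrC divfK// pnatr_eq0.
have := cP u.
rewrite ler_norml => h1 /andP[_ h2].
by nra.
Qed.

End lower.

(** * A causal piece of small null length stays in a chart *)

Section trap.
Variables (R : realType) (n : nat) (M : topologicalType).
Local Notation E := 'rV[R]_n.+1.
Variables (A : charts E M) (T : R).
Hypothesis atlasA : smooth_atlas A.
Hypothesis hausM : hausdorff_space M.
Local Notation A' := (time_charts A).
Local Notation point := (R * M)%type.
Local Notation slab := (@slab R M T).
Local Notation cslab := (@closed_slab R M T).

Section piece.
Variables (a b : R) (alpha : R -> point).
Hypothesis ab : a < b.
Hypothesis ca : {within `[a, b], continuous alpha}.
Hypothesis sa : smooth_curve A a b alpha.

Lemma piece_differentiable (i : idx A') s : a < s < b -> dom i (alpha s) ->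
  differentiable (coord i \o alpha) s.
Proof. by move=> sab ds; have [+ _] := sa i 1%N; apply; split=> //=; rewrite in_itv. Qed.

(** Time is a coordinate of every chart, so its monotonicity holds along the
    whole piece, whatever charts the piece goes through. *)
Lemma piece_time_mono (k : R) :
  (forall s (i : idx A'), a < s < b -> dom i (alpha s) ->
     0 <= k * (velocity alpha i s).1) ->
  forall s s', a <= s -> s <= s' -> s' <= b -> k * (alpha s).1 <= k * (alpha s').1.
Proof.
move=> kv s s' as_ ss' sb.
have G r : a < r < b -> differentiable (fun r => k * (alpha r).1) r /\
    0 <= (fun r => k * (alpha r).1)^`()%classic r.
  move=> rab; have [i di] := dom_cover atlasA (alpha r).2.
  pose l (z : R * E) : R := k * z.1.
  have ll : linear l.
    by move=> x u v; rewrite /l /= -[x *: u.1]/(x * u.1) -[x *: _]/(x * _); ring.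
  pose L : {linear (R * E)%type -> R} := HB.pack l (GRing.isLinear.Build _ _ _ _ l ll).
  have cL : continuous L.
    by move=> z; apply: cvgM; [exact: cvg_cst|exact: cvg_fst].
  have [dL LE] := derive1_comp_linear cL (piece_differentiable (i := i) rab di).
  split; first exact: dL.
  by have := kv r i rab di; congr (_ <= _); exact: esym LE.
apply: (@ger0_derive1_le_cc R (fun r => k * (alpha r).1) a b) => //.
- by move=> r; rewrite in_itv/= => /G[/derivable1_diffP].
- by move=> r; rewrite in_itv/= => /G[].
- apply/subspace_continuousP => r rab; move/subspace_continuousP : ca => /(_ r rab) cr.
  apply: cvgM; first exact: cvg_cst.
  by apply: cvg_comp cr _; exact: cvg_fst.
- by rewrite in_itv/= as_ (le_trans ss').
- by rewrite in_itv/= sb (le_trans as_).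
Qed.

Variables (i : idx A) (y0 : E) (t0 r k : R).
Hypothesis ball_image : forall y, `|y - y0| < r -> (coord i @` dom i) y.
Hypothesis time_mono : forall s, a <= s <= b ->
  0 <= k * ((alpha s).1 - (alpha a).1) <= k * ((alpha b).1 - (alpha a).1).
Hypothesis time_ball : forall s, a <= s <= b -> `|(alpha s).1 - t0| < r.
Hypothesis cone : forall s, a < s < b -> dom i (alpha s).2 ->
  `|coord i (alpha s).2 - y0| < r -> `|(alpha s).1 - t0| < r ->
  `|(velocity alpha (i : idx A') s).2| <= k * (velocity alpha (i : idx A') s).1.
Hypothesis start_dom : dom i (alpha a).2.
Hypothesis start_ball :
  `|coord i (alpha a).2 - y0| + k * ((alpha b).1 - (alpha a).1) < r.

Let P s := dom i (alpha s).2 /\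
  `|coord i (alpha s).2 - coord i (alpha a).2| <= k * ((alpha s).1 - (alpha a).1).

Let region s := dom i (alpha s).2 /\ `|coord i (alpha s).2 - y0| < r.

Let P_region s : a <= s <= b -> P s -> region s.
Proof.
move=> sab [ds Ps]; split=> //.
rewrite -(subrKA (coord i (alpha a).2)) (le_lt_trans (ler_normD _ _))//.
rewrite addrC (le_lt_trans _ start_ball)// lerD2l (le_trans Ps)//.
by case/andP: (time_mono sab).
Qed.

Let region_P s : a <= s <= b -> (forall s', a <= s' <= s -> region s') -> P s.
Proof.
move=> /andP[as_ sb] reg; split; first by have [] := reg s; rewrite ?as_ ?lexx.
have sub s' : a < s' < s -> a < s' < b by move=> /andP[-> /lt_le_trans]; apply.
have reg' s' : a < s' < s -> region s' by move=> /andP[/ltW h1 /ltW h2]; apply: reg; rewrite h1.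
apply: (@mean_value_cone R n (coord (i : idx A') \o alpha) k a s as_).
- apply/subspace_continuousP => s' /=; rewrite in_itv/= => /andP[as' s's].
  move/subspace_continuousP : ca => /(_ s').
  rewrite /= in_itv/= as' (le_trans s's sb) => /(_ isT) cs'.
  have [ds' _] : region s' by apply: reg; rewrite as'.
  have cs : alpha @ within (fun x => x \in `[a, s]) (nbhs s') --> alpha s'.
    apply: cvg_trans cs' => B; rewrite /= /within /= !nbhs_simpl /=.
    apply: filterS => x + xs; apply; move: xs; rewrite !in_itv/= => /andP[-> xs].
    exact: le_trans sb.
  have c1 : (alpha x).1 @[x --> within (fun x => x \in `[a, s]) (nbhs s')] --> (alpha s').1.
    by apply: cvg_comp cs _; exact: cvg_fst.
  have c2 : coord i (alpha x).2 @[x --> within (fun x => x \in `[a, s]) (nbhs s')] --> coord i (alpha s').2.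
    apply: (@cvg_comp _ _ _ (fun x => (alpha x).2) (coord i)); last exact: (coord_cont atlasA ds').
    by apply: cvg_comp cs _; exact: cvg_snd.
  exact: cvg_pair c1 c2.
- by move=> s' s's; apply: piece_differentiable; [exact: sub|have [] := reg' _ s's].
- move=> s' s's; have [ds' bs'] := reg' _ s's; apply: cone => //; first exact: sub.
  by apply: time_ball; case/andP: (sub _ s's) => /ltW-> /ltW->.
Qed.

(** Up to the sign given by the time orientation of the piece, [k] is the
    slope of the cones.  While the curve stays in the ball of radius [r], the mean value inequality
    keeps it in the smaller closed ball of radius [k (t(b) - t(a))] around its
    starting point.  This closed ball is the image of a compact set, hence
    closed in the Hausdorff space [M], so the curve cannot leave it at a first
    time, and the ball of radius [r] is open, so the curve stays in it a little
    longer. *)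
Lemma piece_trapped s : a <= s <= b -> P s.
Proof.
apply: itv_induction; first exact: ltW.
- by split=> //; rewrite !subrr mulr0 normr0.
- move=> {}s /andP[as_ sb] Pa.
  have [ds bs] : region s by apply: P_region; [rewrite as_ ltW|apply: Pa; rewrite as_ lexx].
  have near_reg : \forall x \near s, a <= x <= b -> region x.
    move/subspace_continuousP : ca => /(_ s).
    rewrite /= in_itv/= as_ ltW// => /(_ isT) cs.
    have n1 : \forall q \near alpha s, dom i q.2 /\ `|coord i q.2 - y0| < r.
      apply: filterI.
        by apply: open_nbhs_nbhs; split=> //; exact: (@open_time_dom _ _ _ _ atlasA i).
      have cc : coord i q.2 @[q --> alpha s] --> coord i (alpha s).2.
        apply: (@cvg_comp _ _ _ snd (coord i)); last exact: (coord_cont atlasA ds).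
        exact: cvg_snd.
      have oB : open [set y : E | `|y - y0| < r].
        rewrite (_ : [set y : E | _] = ball y0 r); last first.
          by apply/seteqP; split=> y; rewrite -ball_normE /ball_/= distrC.
        exact: ball_open.
      exact: cc (open_nbhs_nbhs (conj oB bs)).
    have := cs _ n1; rewrite /within /= !nbhs_simpl /=.
    by apply: filterS => x + xab; apply; rewrite in_itv.
  have /nbhs_ballP[e /= e0 eP] := near_reg.
  exists (s + e / 2); first by rewrite ltrDl divr_gt0.
  move=> s' /andP[ss' s'e] s'b; apply: region_P.
    by rewrite s'b (le_trans as_)// ltW.
  move=> x /andP[ax xs']; have [xs|sx] := leP x s.
    by apply: P_region; [rewrite ax (le_trans xs)// ltW|apply: Pa; rewrite ax].
  apply: eP; last by rewrite ax (le_trans xs').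
  rewrite -ball_normE /ball_/= distrC gtr0_norm ?subr_gt0//.
  rewrite ltrBlDl (le_lt_trans xs')// (le_lt_trans s'e)// ltrD2l.
  by rewrite gtr_pMr// invf_lt1// ltr1n.
- move=> {}s /andP[as_ sb] Pa.
  have as' := ltW as_.
  pose rho := k * ((alpha b).1 - (alpha a).1).
  have rho0 : 0 <= rho by have := time_mono (s := b); rewrite lexx (ltW ab) => /(_ isT)/andP[].
  (* The compact set in which the estimate confines the curve. *)
  pose F : set M := param i @` [set y | `|y - coord i (alpha a).2| <= rho].
  have sub_image y : `|y - coord i (alpha a).2| <= rho -> (coord i @` dom i) y.
    move=> yr; apply: ball_image.
    rewrite -(subrKA (coord i (alpha a).2)) (le_lt_trans (ler_normD _ _))//.
    by rewrite addrC (le_lt_trans _ start_ball)// lerD2l.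
  have clF : closed F.
    apply: compact_closed => //; apply: continuous_compact.
      apply: continuous_in_subspaceT => y; rewrite inE /= => yr.
      exact: (param_cont atlasA (sub_image _ yr)).
    apply: bounded_closed_compact.
      exists (rho + `|coord i (alpha a).2|); split; first exact: num_real.
      move=> x xr y /= yr; rewrite -(subrK (coord i (alpha a).2) y).
      by rewrite (le_trans (ler_normD _ _))// ltW// (le_lt_trans _ xr)// lerD2r.
    rewrite (_ : [set y : E | _] = closed_ball_ Num.norm (coord i (alpha a).2) rho).
      exact: closed_closed_ball_.
    by apply/seteqP; split=> y; rewrite /closed_ball_/= distrC.
  have PF x : a <= x <= b -> P x -> F (alpha x).2.
    move=> xab [dx Px]; exists (coord i (alpha x).2); last exact: (coordK atlasA).
    by apply: le_trans Px _; case/andP: (time_mono xab).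
  have Fs : F (alpha s).2.
    rewrite (closure_id F).1// => B nB.
    move/subspace_continuousP : ca => /(_ s).
    rewrite /= in_itv/= as' sb => /(_ isT) cs.
    have nB' : \forall q \near alpha s, B q.2 by exact: cvg_snd nB.
    have := cs _ nB'; rewrite /within /= !nbhs_simpl /= => /nbhs_ballP[e /= e0 eP].
    pose x := Num.max a (s - e / 2).
    have xs : x < s by rewrite gt_max as_ ltrBlDr ltrDl divr_gt0.
    have xab : a <= x <= b by rewrite le_max lexx (le_trans (ltW xs)).
    exists (alpha x).2; split; first by apply: PF => //; apply: Pa; rewrite xs; case/andP: xab => ->.
    apply: eP; last by rewrite in_itv.
    rewrite -ball_normE /ball_/= gtr0_norm ?subr_gt0// ltrBlDr -ltrBlDl.
    rewrite lt_max; apply/orP; right; rewrite ltrD2l ltrN2.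
    by rewrite gtr_pMr// invf_lt1// ltr1n.
  apply: region_P; first by rewrite as'.
  move=> x /andP[ax]; rewrite le_eqVlt => /predU1P[->|xs]; last first.
    by apply: P_region; [rewrite ax (le_trans (ltW xs))|apply: Pa; rewrite ax].
  case: Fs => y /= yr yE.
  have [dy cy] := paramK atlasA (sub_image _ yr).
  rewrite /region -yE cy; split=> //.
  rewrite -(subrKA (coord i (alpha a).2)) (le_lt_trans (ler_normD _ _))//.
  by rewrite addrC (le_lt_trans _ start_ball)// lerD2l.
Qed.

End piece.
End trap.

(** * Separation of points by the null distance *)

Section separation.
Variables (R : realType) (n : nat) (M : topologicalType).
Local Notation E := 'rV[R]_n.+1.
Variables (A : charts E M) (T : R).
Hypothesis atlasA : smooth_atlas A.
Hypothesis hausM : hausdorff_space M.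
Local Notation A' := (time_charts A).
Local Notation point := (R * M)%type.
Local Notation slab := (@slab R M T).
Local Notation cslab := (@closed_slab R M T).
Variables (h : tensor2 A') (hbar : R -> tensor2 A).
Hypothesis cosmo : cosmological T h.
Hypothesis ext : extends_to_closed_slab T h hbar.

Section trapped.
Variables (i : idx A) (y0 : E) (t0 r c K : R).
Hypothesis ball_image : forall y, `|y - y0| < r -> (coord i @` dom i) y.
Hypothesis form_ge : forall q : point, slab q -> dom i q.2 ->
  `|coord i q.2 - y0| < r -> `|q.1 - t0| < r ->
  forall u, c * `|u| ^+ 2 <= hbar q.1 i q.2 u u.
Hypothesis K0 : 0 < K.
Hypothesis Kc : 1 <= K ^+ 2 * c.

Lemma causal_cone (u : E) (q : point) (v sg : R) : slab q -> dom i q.2 ->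
  `|coord i q.2 - y0| < r -> `|q.1 - t0| < r ->
  hbar q.1 i q.2 u u <= v ^+ 2 -> 0 <= sg * v -> sg ^+ 2 = 1 -> `|u| <= K * (sg * v).
Proof.
move=> sq dq bq tq uv sv sg1.
have := form_ge sq dq bq tq u => /le_trans/(_ uv) cu.
rewrite -ler_sqr ?nnegrE ?(mulr_ge0 (ltW K0))//.
rewrite !exprMn sg1 mul1r.
have u2 : 0 <= `|u| ^+ 2 by exact: sqr_ge0.
apply: (@le_trans _ _ (K ^+ 2 * c * `|u| ^+ 2)); first by rewrite ler_peMl.
by rewrite -mulrA ler_wpM2l// sqr_ge0.
Qed.

Lemma piece_orientation m s alpha k : piecewise_causal T h m s alpha -> (k < m)%N ->
  exists sg : R, [/\ sg ^+ 2 = 1 & forall x (j : idx A'), s k < x < s k.+1 ->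
    dom j (alpha x) -> 0 <= sg * (velocity alpha j x).1 /\
    hbar (alpha x).1 j (alpha x).2 (velocity alpha j x).2 (velocity alpha j x).2
      <= (velocity alpha j x).1 ^+ 2].
Proof.
move=> pc km; have [F|P] := pc_causal pc km.
  exists 1; split=> [|x j xk dx]; first by rewrite expr1n.
  have sx := pc_slab_piece pc km xk.
  have /(future_directedE cosmo ext _ sx dx)[v0 ->] := F x j xk dx.
  by rewrite mul1r ltW.
exists (-1); split=> [|x j xk dx]; first by rewrite sqrrN expr1n.
have sx := pc_slab_piece pc km xk.
have /(past_directedE cosmo ext _ sx dx)[v0 ->] := P x j xk dx.
by rewrite mulN1r oppr_ge0 ltW.
Qed.

(** Induction on the pieces: the displacement in the chart after [l] pieces is
    at most [K] times the null length used so far, which leaves room for the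
    next piece. *)
Lemma reach_trapped p q L : reach T h p q L -> dom i p.2 ->
  `|coord i p.2 - y0| + K * L < r -> `|p.1 - t0| + L < r ->
  dom i q.2 /\ `|coord i q.2 - coord i p.2| <= K * L.
Proof.
move=> [m [s [alpha [pc <- <- ->]]]] dp bp tp.
pose D k := `|(alpha (s k.+1)).1 - (alpha (s k)).1|.
pose Len l := \sum_(k < l) D k.
have LenS l : Len l.+1 = Len l + D l by rewrite /Len big_ord_recr.
have LenE : null_length m s alpha = Len m by [].
have Lenmono l : (l <= m)%N -> Len l <= Len m.
  move=> lm; rewrite -(subnKC lm); elim: (m - l)%N => [|k IH]; first by rewrite addn0.
  by rewrite addnS LenS (le_trans IH)// lerDl normr_ge0.
suff H l : (l <= m)%N -> [/\ dom i (alpha (s l)).2,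
    `|coord i (alpha (s l)).2 - coord i (alpha (s 0%N)).2| <= K * Len l &
    `|(alpha (s l)).1 - (alpha (s 0%N)).1| <= Len l].
  by rewrite LenE; have [] := H m (leqnn m).
elim: l => [|l IH] lm.
  by rewrite /Len big_ord0 !subrr !normr0 mulr0.
have [dl bl tl] := IH (ltnW lm).
have LS := Lenmono _ lm; rewrite LenS in LS.
have ab := pc_partition pc lm.
have ca := pc_cont_piece pc lm.
have sa := pc_smooth pc lm.
(* [sg] is the sign of the speed of [t] on the current piece. *)
have [sg [sg1 orient]] := piece_orientation pc lm.
have mono x x' : s l <= x -> x <= x' -> x' <= s l.+1 ->
    sg * (alpha x).1 <= sg * (alpha x').1.
  by apply: (piece_time_mono atlasA ca sa) => y j yk dy; have [] := orient y j yk dy.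
have abs_sg x y : s l <= x -> x <= y -> y <= s l.+1 ->
    `|(alpha y).1 - (alpha x).1| = sg * ((alpha y).1 - (alpha x).1).
  move=> h1 h2 h3; have := mono _ _ h1 h2 h3.
  have /eqP := sg1; rewrite sqrf_eq1 => /orP[]/eqP-> .
    by rewrite !mul1r => h4; rewrite ger0_norm// subr_ge0.
  by rewrite !mulN1r lerN2 => h4; rewrite ler0_norm// subr_le0.
have time_mono x : s l <= x <= s l.+1 ->
   0 <= K * sg * ((alpha x).1 - (alpha (s l)).1)
     <= K * sg * ((alpha (s l.+1)).1 - (alpha (s l)).1).
  move=> /andP[x1 x2]; rewrite -!mulrA; apply/andP; split.
    by rewrite mulr_ge0 ?(ltW K0)// mulrBr subr_ge0 mono.
  by rewrite ler_wpM2l ?(ltW K0)// !mulrBr lerD2r mono.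
have time_D x : s l <= x <= s l.+1 -> `|(alpha x).1 - (alpha (s l)).1| <= D l.
  move=> /andP[x1 x2]; rewrite /D abs_sg// abs_sg ?(ltW ab)//.
  by rewrite !mulrBr lerD2r mono.
have time_ball x : s l <= x <= s l.+1 -> `|(alpha x).1 - t0| < r.
  move=> xs; apply: le_lt_trans tp; rewrite LenE.
  have -> : (alpha x).1 - t0 = ((alpha x).1 - (alpha (s l)).1) +
    ((alpha (s l)).1 - (alpha (s 0%N)).1) + ((alpha (s 0%N)).1 - t0) by ring.
  rewrite (le_trans (ler_normD _ _))// addrC lerD2l (le_trans (ler_normD _ _))//.
  by rewrite (le_trans _ LS)// addrC lerD// time_D.
have cone x : s l < x < s l.+1 -> dom i (alpha x).2 ->
    `|coord i (alpha x).2 - y0| < r -> `|(alpha x).1 - t0| < r ->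
    `|(velocity alpha (i : idx A') x).2| <= K * sg * (velocity alpha (i : idx A') x).1.
  move=> xs dx bx tx; have [v0 vh] := orient x i xs dx.
  by rewrite -mulrA; apply: causal_cone vh v0 sg1 => //; exact: (pc_slab_piece pc lm xs).
have start : `|coord i (alpha (s l)).2 - y0| +
    K * sg * ((alpha (s l.+1)).1 - (alpha (s l)).1) < r.
  rewrite -mulrA -abs_sg ?(ltW ab)// -/(D l).
  apply: le_lt_trans bp; rewrite LenE -(subrKA (coord i (alpha (s 0%N)).2)).
  have := ler_normD (coord i (alpha (s l)).2 - coord i (alpha (s 0%N)).2)
    (coord i (alpha (s 0%N)).2 - y0).
  move=> h1; have : K * (Len l + D l) <= K * Len m by rewrite (ler_wpM2l (ltW K0)).
  by rewrite mulrDr; lra.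
have sb : s l <= s l.+1 <= s l.+1 by rewrite lexx (ltW ab).
have [dS bS] := piece_trapped atlasA hausM ab ca sa ball_image time_mono
  time_ball cone dl start sb.
split=> //.
  rewrite LenS mulrDr -(subrKA (coord i (alpha (s l)).2)).
  rewrite (le_trans (ler_normD _ _))// addrC lerD//.
  by rewrite (le_trans bS)// -mulrA -abs_sg ?(ltW ab).
rewrite LenS -(subrKA (alpha (s l)).1).
by rewrite (le_trans (ler_normD _ _))// addrC lerD.
Qed.
End trapped.

(** The lower estimate.  The point [p] may lie on the boundary of the slab,
    as the separation is needed for the extended distance. *)
Lemma reach_separated (p q : point) : cslab p -> p <> q ->
  exists (U V : set point) (e : R), [/\ nbhs p U, nbhs q V, 0 < e &
    forall p' q' L, U p' -> V q' -> reach T h p' q' L -> e <= L].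
Proof.
move=> cp pq.
have hausN : hausdorff_space point.
  move=> x y xy; rewrite [x]surjective_pairing [y]surjective_pairing; congr pair.
    apply: (@Rhausdorff R) => B C nB nC.
    have [z [Bz Cz]] := xy _ _ (cvg_fst nB) (cvg_fst nC).
    by exists z.1.
  apply: hausM => B C nB nC.
  have [z [Bz Cz]] := xy _ _ (cvg_snd nB) (cvg_snd nC).
  by exists z.2.
have [U0 [V [U0p Vq UV]]] : exists U0 V : set point, [/\ nbhs p U0, nbhs q V & U0 `&` V = set0].
  move/eqP : pq => pq; move: (hausN); rewrite open_hausdorff => /(_ _ _ pq)[[B C] /=].
  rewrite !inE => -[Bp Cq] [oB oC BC]; exists B, C; split.
  - exact: open_nbhs_nbhs.
  - exact: open_nbhs_nbhs.
  - exact: BC.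
have [i dp] := dom_cover atlasA p.2.
set t0 := p.1; set y0 := coord i p.2.
have iy0 : (coord i @` dom i) y0 by exists p.2.
have [c c0 cP] := hbar_locally_ge cosmo ext cp dp.
have cparam : (z.1, param i z.2) @[z --> (t0, y0)] --> p.
  have pE : p = (t0, param i y0) by rewrite /t0 /y0 (coordK atlasA)// -surjective_pairing.
  rewrite [X in _ --> X]pE.
  have c2 : param i z.2 @[z --> (t0, y0)] --> param i y0.
    apply: (@cvg_comp _ _ _ snd (param i)); first exact: cvg_snd.
    exact: (param_cont atlasA iy0).
  have c1 : z.1 @[z --> (t0, y0)] --> t0 by exact: cvg_fst.
  exact: cvg_pair c1 c2.
have : \forall z \near (t0, y0), (coord i @` dom i) z.2 /\
    (U0 (z.1, param i z.2) /\ (slab (z.1, param i z.2) -> dom i (param i z.2) ->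
      forall u, c * `|u| ^+ 2 <= hbar z.1 i (param i z.2) u u)).
  apply: filterI.
    have o := open_nbhs_nbhs (conj (image_open atlasA i) iy0).
    exact: cvg_snd o.
  by apply: filterI; [exact: cparam U0p|exact: cparam cP].
move=> /nbhs_ballP[r /= r0 rP].
have inB (z : R * E) : `|z.2 - y0| < r -> `|z.1 - t0| < r -> ball (t0, y0) r z.
  by move=> z2 z1; split; rewrite -ball_normE /ball_/= distrC.
(* Any [K] with [1 <= K ^ 2 * c] bounds the slope of the causal cones. *)
pose K := 1 + c^-1.
have ci0 : 0 < c^-1 by rewrite invr_gt0.
have K0 : 0 < K by rewrite addr_gt0.
have Kc : 1 <= K ^+ 2 * c.
  have -> : K ^+ 2 * c = c + 2 + c^-1 by rewrite /K; field; rewrite gt_eqF.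
  by lra.
have ball_image y : `|y - y0| < r -> (coord i @` dom i) y.
  move=> yr; have [] := rP (t0, y); first by apply: inB; rewrite //= subrr normr0.
  by [].
have form_ge (q' : point) : slab q' -> dom i q'.2 ->
  `|coord i q'.2 - y0| < r -> `|q'.1 - t0| < r ->
  forall u, c * `|u| ^+ 2 <= hbar q'.1 i q'.2 u u.
  move=> sq dq bq tq; have [_ [_]] := rP (q'.1, coord i q'.2) (inB (q'.1, coord i q'.2) bq tq).
  by rewrite /= (coordK atlasA)// -surjective_pairing; apply.
pose U := [set p' : point | dom i p'.2 /\ `|coord i p'.2 - y0| < r / 2] `&`
          [set p' : point | `|p'.1 - t0| < r / 2].
have r20 : 0 < r / 2 by rewrite divr_gt0.
(* Half of the radius is spent on the distance from [p] to [p'], and half on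
   the displacement along the curve, both in space and in time. *)
exists U, V, (Num.min (r / 2) (r / 2 / K)); split=> //.
- apply: filterI.
    apply: filterI.
      by apply: open_nbhs_nbhs; split=> //; exact: (@open_time_dom _ _ _ _ atlasA i).
    have cc : coord i q.2 @[q --> p] --> y0.
      apply: (@cvg_comp _ _ _ snd (coord i)); last exact: (coord_cont atlasA dp).
      exact: cvg_snd.
    by have /cvgrPdist_lt/(_ _ r20) := cc; apply: filterS => z; rewrite distrC.
  have c1 : z.1 @[z --> p] --> t0 by exact: cvg_fst.
  by have /cvgrPdist_lt/(_ _ r20) := c1; apply: filterS => z; rewrite distrC.
- by rewrite lt_min r20 divr_gt0.
move=> p' q' L [[dp' bp'] tp'] Vq' pqL; rewrite leNgt; apply/negP.
rewrite lt_min => /andP[L1 L2].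
have KL : K * L < r / 2 by rewrite mulrC -ltr_pdivlMr.
have [|| dq' bq'] := reach_trapped ball_image form_ge K0 Kc pqL dp'.
- by rewrite (splitr r) ltrD.
- by rewrite (splitr r) ltrD.
have tq' := reach_time pqL.
have Bq' : `|coord i q'.2 - y0| < r.
  rewrite -(subrKA (coord i p'.2)) (le_lt_trans (ler_normD _ _))// (splitr r).
  by rewrite ltrD// (le_lt_trans bq').
have Tq' : `|q'.1 - t0| < r.
  rewrite -(subrKA p'.1) (le_lt_trans (ler_normD _ _))// (splitr r).
  by rewrite ltrD// distrC (le_lt_trans tq').
have [_ [Uq' _]] := rP (q'.1, coord i q'.2) (inB (q'.1, coord i q'.2) Bq' Tq').
move: Uq'; rewrite /= (coordK atlasA)// -surjective_pairing => Uq'.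
have : (U0 `&` V) q' by split.
by rewrite UV.
Qed.

End separation.

(** * Extension of a distance by density, and metrics on a compact space *)

Section extension.
Variables (R : realType) (T : topologicalType) (S X : set T) (d : T -> T -> R).
Hypothesis SX : S `<=` X.
Hypothesis denseS : forall x U, X x -> nbhs x U -> exists2 y, S y & U y.
Hypothesis d_refl : forall x, S x -> d x x = 0.
Hypothesis d_sym : forall x y, S x -> S y -> d x y = d y x.
Hypothesis d_triangle : forall x y z, S x -> S y -> S z -> d x z <= d x y + d y z.
Hypothesis d_cont : forall x (e : R), X x -> 0 < e ->
  exists2 U, nbhs x U & forall y z, U y -> U z -> S y -> S z -> d y z <= e.

Let F (p q : T) := within (S `*` S) (nbhs (p, q)).
Let dbar (p q : T) := lim (d x.1 x.2 @[x --> F p q]).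

Let F_proper p q : X p -> X q -> ProperFilter (F p q).
Proof.
move=> Xp Xq; apply: Build_ProperFilter_ex => B /= [[U V] /= [nU nV] UVB].
have [x Sx Ux] := denseS Xp nU; have [y Sy Vy] := denseS Xq nV.
by exists (x, y); apply: UVB.
Qed.

Let d_close x y x' y' (e e' : R) : S x -> S y -> S x' -> S y' ->
  d x x' <= e -> d y y' <= e' -> `|d x y - d x' y'| <= e + e'.
Proof.
move=> Sx Sy Sx' Sy' h1 h2.
have t1 := d_triangle Sx Sx' Sy; have t2 := d_triangle Sx' Sy' Sy.
have t3 := d_triangle Sx' Sx Sy'; have t4 := d_triangle Sx Sy Sy'.
rewrite (d_sym Sy' Sy) in t2; rewrite (d_sym Sx' Sx) in t3.
by rewrite ler_norml; apply/andP; split; lra.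
Qed.

Let dbar_cvg p q : X p -> X q -> d x.1 x.2 @[x --> F p q] --> dbar p q.
Proof.
move=> Xp Xq; have FF := F_proper Xp Xq.
apply/cauchy_cvgP; apply: cauchy_exP => e e0.
have e40 : 0 < e / 4 by rewrite divr_gt0.
have [U nU UP] := d_cont Xp e40; have [V nV VP] := d_cont Xq e40.
have [x Sx Ux] := denseS Xp nU; have [y Sy Vy] := denseS Xq nV.
exists (d x y).
exists (U, V) => //= -[x' y'] /= [Ux' Vy'] [Sx' Sy'].
rewrite -ball_normE /ball_/=.
apply: le_lt_trans (d_close Sx Sy Sx' Sy' (UP _ _ _ _ _ _) (VP _ _ _ _ _ _)) _ => //.
by lra.
Qed.

(** The extension [dbar] is used only through this property: [d] is Cauchy
    along the trace of the neighbourhood filter on [S * S], which is proper by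
    density. *)
Lemma lim_approx p q e : X p -> X q -> 0 < e ->
  exists U V, [/\ nbhs p U, nbhs q V & forall x y, U x -> V y -> S x -> S y ->
    `|dbar p q - d x y| < e].
Proof.
move=> Xp Xq e0; have FF := F_proper Xp Xq.
have /cvgrPdist_lt/(_ e e0)[[U V] /= [nU nV] UVP] := dbar_cvg Xp Xq.
by exists U, V; split=> // x y Ux Vy Sx Sy; exact: (UVP (x, y)).
Qed.

Lemma lim_agree x y : S x -> S y -> dbar x y = d x y.
Proof.
move=> Sx Sy; apply/eqP; rewrite -subr_eq0 -normr_le0; apply/ler_addgt0Pl => e e0.
have [U [V [nU nV UVP]]] := lim_approx (SX Sx) (SX Sy) e0.
by rewrite addr0 ltW// UVP//; exact: nbhs_singleton.
Qed.

Lemma lim_le U V p q c : X p -> X q -> nbhs p U -> nbhs q V ->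
  (forall x y, U x -> V y -> S x -> S y -> d x y <= c) -> dbar p q <= c.
Proof.
move=> Xp Xq nU nV dc; apply/ler_addgt0Pl => e e0.
have [U' [V' [nU' nV' UVP]]] := lim_approx Xp Xq e0.
have [x Sx [Ux U'x]] := denseS Xp (filterI nU nU').
have [y Sy [Vy V'y]] := denseS Xq (filterI nV nV').
have := UVP x y U'x V'y Sx Sy; rewrite ltr_norml => /andP[_ h1].
by have := dc x y Ux Vy Sx Sy; lra.
Qed.

Lemma lim_ge U V p q c : X p -> X q -> nbhs p U -> nbhs q V ->
  (forall x y, U x -> V y -> S x -> S y -> c <= d x y) -> c <= dbar p q.
Proof.
move=> Xp Xq nU nV dc; apply/ler_addgt0Pl => e e0.
have [U' [V' [nU' nV' UVP]]] := lim_approx Xp Xq e0.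
have [x Sx [Ux U'x]] := denseS Xp (filterI nU nU').
have [y Sy [Vy V'y]] := denseS Xq (filterI nV nV').
have := UVP x y U'x V'y Sx Sy; rewrite ltr_norml => /andP[h1 _].
by have := dc x y Ux Vy Sx Sy; lra.
Qed.

Hypothesis d_separated : forall p q, X p -> X q -> p <> q ->
  exists U V e, [/\ nbhs p U, nbhs q V, 0 < e &
    forall x y, U x -> V y -> S x -> S y -> e <= d x y].

(** Each axiom is obtained by choosing points of [S] close to the given ones
    for all the approximations in play at once. *)
Lemma lim_is_metric : is_metric X dbar.
Proof.
split.
- move=> p q Xp Xq; split=> [pq0|<-].
    have [//|pq] := pselect (p = q).
    have [U [V [e [nU nV e0 UVe]]]] := d_separated Xp Xq pq.
    by have := lim_ge Xp Xq nU nV UVe; rewrite pq0 leNgt e0.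
  apply/eqP; rewrite -normr_le0; apply/ler_addgt0Pl => e e0.
  have [U [V [nU nV UVP]]] := lim_approx Xp Xp e0.
  have [x Sx [Ux Vx]] := denseS Xp (filterI nU nV).
  by have := UVP x x Ux Vx Sx Sx; rewrite d_refl// subr0 addr0 => /ltW.
- move=> p q Xp Xq; apply/eqP; rewrite -subr_eq0 -normr_le0; apply/ler_addgt0Pl => e e0.
  have e20 : 0 < e / 2 by rewrite divr_gt0.
  have [U [V [nU nV UVP]]] := lim_approx Xp Xq e20.
  have [V' [U' [nV' nU' UVP']]] := lim_approx Xq Xp e20.
  have [x Sx [Ux U'x]] := denseS Xp (filterI nU nU').
  have [y Sy [Vy V'y]] := denseS Xq (filterI nV nV').
  rewrite addr0; have := UVP _ _ Ux Vy Sx Sy; have := UVP' _ _ V'y U'x Sy Sx.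
  rewrite (d_sym Sy Sx) !ltr_norml => /andP[h1 h2] /andP[h3 h4].
  by rewrite ler_norml; apply/andP; split; lra.
- move=> p q r Xp Xq Xr; apply/ler_addgt0Pl => e e0.
  have e30 : 0 < e / 3 by rewrite divr_gt0.
  have [U1 [V1 [nU1 nV1 P1]]] := lim_approx Xp Xq e30.
  have [U2 [V2 [nU2 nV2 P2]]] := lim_approx Xq Xr e30.
  have [U3 [V3 [nU3 nV3 P3]]] := lim_approx Xp Xr e30.
  have [x Sx [U1x U3x]] := denseS Xp (filterI nU1 nU3).
  have [y Sy [V1y U2y]] := denseS Xq (filterI nV1 nU2).
  have [z Sz [V2z V3z]] := denseS Xr (filterI nV2 nV3).
  have := P1 _ _ U1x V1y Sx Sy; have := P2 _ _ U2y V2z Sy Sz.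
  have := P3 _ _ U3x V3z Sx Sz; have := d_triangle Sx Sy Sz.
  rewrite !ltr_norml => h0 /andP[h1 h2] /andP[h3 h4] /andP[h5 h6].
  by lra.
Qed.

End extension.

Section metric_facts.
Variables (R : realType) (T : Type) (X : set T) (d : T -> T -> R).
Hypothesis met : is_metric X d.

Lemma metric_refl x : X x -> d x x = 0.
Proof. by move=> Xx; apply/(dist_eq0 met). Qed.

Lemma metric_ge0 x y : X x -> X y -> 0 <= d x y.
Proof.
move=> Xx Xy; have := dist_triangle met Xx Xy Xx.
by rewrite metric_refl// (dist_sym met Xy Xx); lra.
Qed.

Lemma metric_quad x y x' y' : X x -> X y -> X x' -> X y' ->
  `|d x y - d x' y'| <= d x x' + d y y'.
Proof.
move=> Xx Xy Xx' Xy'.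
have t1 := dist_triangle met Xx Xx' Xy; have t2 := dist_triangle met Xx' Xy' Xy.
have t3 := dist_triangle met Xx' Xx Xy'; have t4 := dist_triangle met Xx Xy Xy'.
rewrite (dist_sym met Xy' Xy) in t2; rewrite (dist_sym met Xx' Xx) in t3.
by rewrite ler_norml; apply/andP; split; lra.
Qed.

End metric_facts.

(** A finite subcover indexed by points.  The filter on finite sequences is
    the one of all sequences containing a given one. *)
Lemma compact_finite_centers (T : topologicalType) (X : set T) (W : T -> set T) :
  compact X -> (forall c, X c -> nbhs c (W c)) ->
  exists s : seq T, (forall c, c \in s -> X c) /\
    forall x, X x -> exists2 c, c \in s & W c x.
Proof.
move=> /compact_near_coveringP cX nW.
pose F : set_system (seq T) := [set P : set (seq T) | exists s0 : seq T,
  forall s : seq T, {subset s0 <= s} -> P s].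
have FF : Filter F.
  split.
  - by exists [::].
  - move=> P Q [s sP] [t tQ]; exists (s ++ t) => r str; split.
      by apply: sP => x xs; apply: str; rewrite mem_cat xs.
    by apply: tQ => x xt; apply: str; rewrite mem_cat xt orbT.
  - by move=> P Q PQ [s sP]; exists s => r /sP/PQ.
have [s sP] : F [set s : seq T | X `<=` [set x | exists c, [/\ c \in s, X c & W c x]]].
  apply: (cX _ F (fun (s : seq T) x => exists c, [/\ c \in s, X c & W c x])) => x Xx.
  exists (W x, [set s : seq T | x \in s]) => /=.
    by split; [exact: nW|exists [:: x] => s; apply; rewrite mem_seq1].
  by move=> [y s] /= [Wy xs]; exists x.
exists [seq c <- s | `[< X c >]]; split.
  by move=> c; rewrite mem_filter => /andP[/asboolP].
move=> x Xx; have [c [cs Xc Wc]] := sP s (fun _ => id) x Xx.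
by exists c => //; rewrite mem_filter cs andbT; apply/asboolP.
Qed.

Section compact_metric.
Variables (R : realType) (T : topologicalType) (X : set T) (d : T -> T -> R).
Hypothesis compX : compact X.
Hypothesis met : is_metric X d.
Hypothesis d_cont : forall x (e : R), X x -> 0 < e ->
  \forall y \near x, X y -> d x y < e.

Lemma metric_open_open (U : set T) : metric_open X d U -> open (U : set (subspace X)).
Proof.
move=> oU; rewrite openE => x Ux.
suff : nbhs_subspace (x : subspace X) U by [].
have [Xx|nXx] := pselect (X x); last by rewrite -nbhs_subspace_out// => y ->.
rewrite -nbhs_subspace_in//.
have [e e0 eU] := oU x Xx Ux.
by apply: filterS (d_cont Xx e0) => y dy Xy; apply: eU => //; exact: dy.
Qed.

(** The distance to [x] attains a positive minimum on the compact complement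
    of a relatively open neighbourhood of [x]. *)
Lemma open_metric_open (U : set T) : open (U : set (subspace X)) -> metric_open X d U.
Proof.
move=> /open_subspaceP[V oV VU] x Xx Ux.
have UV y : X y -> U y <-> V y.
  move=> Xy; split=> [Uy|Vy].
    by have : (U `&` X) y by []; rewrite -VU => -[].
  by have : (V `&` X) y by []; rewrite VU => -[].
have [K0|/set0P K0] := eqVneq (X `&` ~` V) set0.
  exists 1 => // y Xy _; apply/UV => //; apply: contrapT => nVy.
  by have : (X `&` ~` V) y by []; rewrite K0.
have cK : compact (X `&` ~` V) by apply: compact_closedI => //; exact: open_closedC.
have cd : {within X `&` ~` V, continuous (d x)}.
  apply/subspace_continuousP => y [Xy _]; apply/cvgrPdist_lt => e e0.
  apply: filterS (d_cont Xy e0) => z dz [Xz _].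
  have := metric_quad met Xx Xy Xx Xz; rewrite (metric_refl met)// add0r => /le_lt_trans; apply.
  exact: dz.
have [y /set_mem[Xy nVy] ymin] := compact_EVT_min K0 cK cd.
exists (d x y).
  rewrite lt_neqAle (metric_ge0 met)// andbT eq_sym; apply/eqP => /(dist_eq0 met Xx Xy) xy.
  by apply: nVy; rewrite -xy; apply/UV.
move=> z Xz xz; apply/UV => //; apply: contrapT => nVz.
by have := ymin z (mem_set (conj Xz nVz)); rewrite leNgt xz.
Qed.

Lemma compact_induces_topology : induces_topology X d.
Proof. by move=> U; split; [exact: metric_open_open|exact: open_metric_open]. Qed.

Lemma compact_metric_compact : metric_compact X d.
Proof.
move=> F Fo XF.
have ex x : X x -> exists2 U, F U & \forall y \near x, X y -> U y.
  move=> Xx; have [U FU Ux] := XF x Xx; exists U => //.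
  have [e e0 eU] := Fo U FU x Xx Ux.
  by apply: filterS (d_cont Xx e0) => y dy Xy; apply: eU => //; exact: dy.
pose W (x : T) : set T := xget set0 [set U | F U /\ \forall y \near x, X y -> U y].
have WP x : X x -> F (W x) /\ \forall y \near x, X y -> W x y.
  move=> /ex[U FU nU].
  have exU : exists U, [set U | F U /\ \forall y \near x, X y -> U y] U by exists U.
  exact: (xgetPex set0 exU).
have [s [sX sP]] := compact_finite_centers (W := fun x => [set y | X y -> W x y])
  compX (fun c Xc => proj2 (WP c Xc)).
exists (W @` [set` s]); split.
- by move=> _ [x /= /sX Xx <-]; have [] := WP x Xx.
- exact/finite_image/finite_seq.
- by move=> x Xx; have [c cs Wc] := sP x Xx; exists (W c); [exists c|exact: Wc].
Qed.

(** A Cauchy sequence converges to any of its cluster points. *)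
Lemma compact_metric_complete : metric_complete X d.
Proof.
move=> u uX uC.
have XF : (u @ \oo) X by exists 0%N => // k _; exact: uX.
have [x [Xx clx]] := compX _ XF.
exists x => //; apply/cvgrPdist_lt => e e0.
have e20 : 0 < e / 2 by rewrite divr_gt0.
have [K KP] := uC _ e20.
have tailF : (u @ \oo) (u @` [set k | (K <= k)%N]).
  by exists K => // k Kk; exists k.
have [_ [[l /= Kl <-] dxl]] := clx _ _ tailF (d_cont Xx e20).
exists K => // k /= Kk; rewrite sub0r normrN ger0_norm ?(metric_ge0 met)//.
rewrite (le_lt_trans (dist_triangle met (uX k) (uX l) Xx))//.
by rewrite (splitr e) ltrD ?KP// (dist_sym met (uX l) Xx) dxl.
Qed.

Lemma compact_metric_bounded x : X x -> exists C, forall y, X y -> d x y <= C.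
Proof.
move=> Xx; have [s [sX sP]] := compact_finite_centers compX (fun c Xc => d_cont Xc ltr01).
exists (\sum_(c <- s) d x c + 1) => y Xy.
have [c cs /(_ Xy) cy] := sP y Xy.
rewrite (le_trans (dist_triangle met Xx (sX _ cs) Xy))//.
apply: lerD; last exact: ltW.
rewrite (big_rem c)//= lerDl big_seq sumr_ge0// => c' /mem_rem c's.
by rewrite (metric_ge0 met)//; exact: sX.
Qed.

(** The union of finite [1/(k+1)]-nets, enumerated through a coding of pairs
    of natural numbers. *)
Lemma compact_dense_seq : X !=set0 -> exists xs, dense_seq X d xs.
Proof.
move=> [x0 Xx0].
have net k : exists l : seq T, (forall c, c \in l -> X c) /\
    forall x, X x -> exists2 c, c \in l & d c x < k.+1%:R^-1.
  have k0 : 0 < k.+1%:R^-1 :> R by rewrite invr_gt0.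
  have [s [sX sP]] := compact_finite_centers compX (fun c Xc => d_cont Xc k0).
  by exists s; split=> // x Xx; have [c cs dc] := sP x Xx; exists c => //; exact: dc.
pose l k := sval (cid (net k)).
have [lX lP] : (forall k c, c \in l k -> X c) /\
    forall k x, X x -> exists2 c, c \in l k & d c x < k.+1%:R^-1.
  by split=> k; have [] := svalP (cid (net k)).
pose xs m := if (unpickle m : option (nat * nat)) is Some kj then nth x0 (l kj.1) kj.2 else x0.
exists xs; split.
  move=> m; rewrite /xs; case: (unpickle m) => [[k j]|]//=.
  have [jl|jl] := ltnP j (size (l k)); last by rewrite nth_default.
  by apply: (lX k); exact: mem_nth.
move=> x e Xx e0.
have [k ke] : exists k, k.+1%:R^-1 < e.
  by have [k _ /(_ k (leqnn k))] := near_infty_natSinv_lt (PosNum e0); exists k.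
have [c cl dc] := lP k x Xx.
exists (pickle (k, index c (l k))); rewrite /xs pickleK/= nth_index//.
exact: lt_trans ke.
Qed.

End compact_metric.

(** * Increasing limits of equicontinuous metrics *)

Section limit.
Variables (R : realType) (T : topologicalType) (X : set T) (D : nat -> T -> T -> R).
Hypothesis compX : compact X.
Hypothesis met : forall j, is_metric X (D j).
Hypothesis mono : forall j x y, X x -> X y -> D j x y <= D j.+1 x y.
Hypothesis bounded : forall x y, X x -> X y -> exists C, forall j, D j x y <= C.
Hypothesis equicont : forall x (e : R), X x -> 0 < e ->
  exists2 U, nbhs x U & forall j y z, U y -> U z -> X y -> X z -> D j y z <= e.

Let dinf (x y : T) := lim (D j x y @[j --> \oo]).

Lemma dinf_cvg x y : X x -> X y -> D j x y @[j --> \oo] --> dinf x y.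
Proof.
move=> Xx Xy; apply: nondecreasing_is_cvgn.
  by apply/nondecreasing_seqP => j; exact: mono.
by have [C CP] := bounded Xx Xy; exists C => _ [j _ <-].
Qed.

Lemma le_dinf j x y : X x -> X y -> D j x y <= dinf x y.
Proof.
move=> Xx Xy; apply: nondecreasing_cvgn_le.
  by apply/nondecreasing_seqP => k; exact: mono.
exact: dinf_cvg.
Qed.

Lemma dinf_le x y c : X x -> X y -> (forall j, D j x y <= c) -> dinf x y <= c.
Proof.
move=> Xx Xy Dc; apply: limr_le; first exact: dinf_cvg.
by near=> j; exact: Dc.
Unshelve. all: by end_near. Qed.

(** Only the definiteness does not pass to the limit by itself; it comes from
    the lower bound [D 0 <= dinf]. *)
Lemma dinf_is_metric : is_metric X dinf.
Proof.
split.
- move=> x y Xx Xy; split=> [d0|<-].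
    apply/(dist_eq0 (met 0) Xx Xy); apply/eqP; rewrite eq_le (metric_ge0 (met 0))// andbT.
    by rewrite -d0; exact: le_dinf.
  apply/cvg_lim => //; rewrite (_ : (fun j => D j x x) = fun=> 0); first exact: cvg_cst.
  by apply/funext => j; rewrite (metric_refl (met j)).
- move=> x y Xx Xy.
  have E : (fun j => D j x y) = (fun j => D j y x).
    by apply/funext => j; exact: (dist_sym (met j)).
  by rewrite /dinf E.
- move=> x y z Xx Xy Xz; apply: dinf_le => // j.
  by rewrite (le_trans (dist_triangle (met j) Xx Xy Xz))// lerD// le_dinf.
Qed.

Lemma dinf_cont x e : X x -> 0 < e ->
  exists2 U, nbhs x U & forall y z, U y -> U z -> X y -> X z -> dinf y z <= e.
Proof.
move=> Xx e0; have [U nU UP] := equicont Xx e0; exists U => // y z Uy Uz Xy Xz.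
by apply: dinf_le => // j; exact: UP.
Qed.

Lemma near_all_seq (I : eqType) (s : seq I) (P : I -> nat -> Prop) :
  (forall i, i \in s -> \forall j \near \oo, P i j) ->
  \forall j \near \oo, forall i, i \in s -> P i j.
Proof.
elim: s => [|i s IH] sP; first by apply: nearW => j i; rewrite in_nil.
have h1 := sP i (mem_head _ _).
have h2 : \forall j \near \oo, forall i, i \in s -> P i j.
  by apply: IH => k ks; apply: sP; rewrite inE ks orbT.
apply: filterS2 h1 h2 => j Pi Ps k; rewrite inE => /predU1P[->//|]; exact: Ps.
Qed.

(** Equicontinuity reduces the estimate to the pairs of points of a finite
    net, where pointwise convergence is enough; four errors come from moving
    [x] and [y] to the net and one from the net, whence [e / 5]. *)
Lemma dinf_uniform e : 0 < e ->
  \forall j \near \oo, forall x y, X x -> X y -> `|D j x y - dinf x y| <= e.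
Proof.
move=> e0; have e50 : 0 < e / 5 by rewrite divr_gt0.
pose W (c : T) : set T := xget set0 [set U : set T | nbhs c U /\
  forall j y z, U y -> U z -> X y -> X z -> D j y z <= e / 5].
have WP c : X c -> nbhs c (W c) /\
    forall j y z, W c y -> W c z -> X y -> X z -> D j y z <= e / 5.
  move=> Xc; have [U nU UP] := equicont Xc e50.
  have exU : exists U, [set U : set T | nbhs c U /\
    forall j y z, U y -> U z -> X y -> X z -> D j y z <= e / 5] U by exists U.
  exact: (xgetPex set0 exU).
have [s [sX sP]] := compact_finite_centers compX (fun c Xc => proj1 (WP c Xc)).
have : \forall j \near \oo, forall c, c \in s -> forall c', c' \in s ->
    `|D j c c' - dinf c c'| <= e / 5.
  apply: near_all_seq => c cs; apply: near_all_seq => c' c's.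
  have /cvgrPdist_le/(_ _ e50) := dinf_cvg (sX _ cs) (sX _ c's).
  by apply: filterS => j; rewrite distrC.
apply: filterS => j jP x y Xx Xy.
have [c cs cx] := sP x Xx; have [c' c's c'y] := sP y Xy.
have [Xc Xc'] := (sX _ cs, sX _ c's).
have close k x' c0 : X x' -> c0 \in s -> W c0 x' -> D k x' c0 <= e / 5.
  move=> Xx' c0s Wx'; have [nW WPc] := WP _ (sX _ c0s).
  by apply: WPc => //; [exact: nbhs_singleton|exact: sX].
have closei x' c0 : X x' -> c0 \in s -> W c0 x' -> dinf x' c0 <= e / 5.
  by move=> Xx' c0s Wx'; apply: dinf_le => //; [exact: sX|move=> k; exact: close].
have h1 := metric_quad (met j) Xx Xy Xc Xc'.
have h2 := metric_quad dinf_is_metric Xx Xy Xc Xc'.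
have h3 := jP c cs c' c's.
have := close j x c Xx cs cx; have := close j y c' Xy c's c'y.
have := closei x c Xx cs cx; have := closei y c' Xy c's c'y.
move: h1 h2 h3; rewrite !ler_norml => /andP[? ?] /andP[? ?] /andP[? ?] ? ? ? ?.
by apply/andP; split; lra.
Qed.

Lemma dinf_uniform_cvg :
  {uniform X `*` X, (fun j x => D j x.1 x.2) @ \oo --> (fun x => dinf x.1 x.2)}.
Proof.
move=> P /uniform_nbhs[E [entE EP]].
have [e /= e0 eE] : exists2 e : R, 0 < e & [set xy | ball xy.1 e xy.2] `<=` E.
  by move: entE; rewrite -entourage_ballE => -[e /= e0 eE]; exists e.
have e20 : 0 < e / 2 by rewrite divr_gt0.
have := dinf_uniform e20; rewrite near_simpl; apply: filterS => j jP.
apply: EP => -[x y] [/= Xx Xy]; apply: eE; rewrite /= -ball_normE /ball_/= distrC.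
by rewrite (le_lt_trans (jP x y Xx Xy))// ltr_pdivrMr// ltr_pMr// ltr1n.
Qed.

End limit.

(** * Uniformly close metrics are Gromov-Hausdorff close *)

Section bounded_functions.
Variables (R : realType) (T : Type).

Definition bounded_fun := {f : T -> R | `[< exists C, forall x, `|f x| <= C >]}.

HB.instance Definition _ := Choice.on bounded_fun.

Implicit Types f g : bounded_fun.

(** The value [0] makes the set nonempty even if [T] is empty. *)
Let gaps f g : set R := [set 0] `|` range (fun x => `|val f x - val g x|).
Definition sup_dist f g : R := sup (gaps f g).

Let has_sup_gaps f g : has_sup (gaps f g).
Proof.
split; first by exists 0; left.
have [C CP] := asboolP _ (valP f); have [C' CP'] := asboolP _ (valP g).
exists (`|C| + `|C'|) => _ [->|[x _ <-]]; first by rewrite addr_ge0.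
rewrite (le_trans (ler_normB _ _))// lerD//.
  by rewrite (le_trans (CP x))// ler_norm.
by rewrite (le_trans (CP' x))// ler_norm.
Qed.

Lemma sup_dist_ub f g x : `|val f x - val g x| <= sup_dist f g.
Proof. by apply: sup_upper_bound => //; right; exists x. Qed.

Lemma sup_dist_le f g c : 0 <= c -> (forall x, `|val f x - val g x| <= c) ->
  sup_dist f g <= c.
Proof.
move=> c0 fgc; apply: ge_sup; first by exists 0; left.
by move=> _ [->//|[x _ <-]].
Qed.

Lemma sup_dist_ge0 f g : 0 <= sup_dist f g.
Proof. by apply: sup_upper_bound => //; left. Qed.

Let sup_distxx f : sup_dist f f = 0.
Proof.
apply/eqP; rewrite eq_le sup_dist_ge0 andbT; apply: sup_dist_le => // x.
by rewrite subrr normr0.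
Qed.

Let sup_dist_eq f g : sup_dist f g = 0 -> f = g.
Proof.
move=> fg0; apply/val_inj/funext => x; apply/eqP; rewrite -subr_eq0 -normr_le0.
by rewrite -fg0; exact: sup_dist_ub.
Qed.

Let sup_dist_sym f g : sup_dist f g = sup_dist g f.
Proof.
apply: le_anti; apply/andP; split; apply: sup_dist_le; rewrite ?sup_dist_ge0// => x;
  by rewrite distrC sup_dist_ub.
Qed.

Let sup_dist_triangle g f k : sup_dist f k <= sup_dist f g + sup_dist g k.
Proof.
apply: sup_dist_le => [|x]; first by rewrite addr_ge0// sup_dist_ge0.
rewrite -(subrKA (val g x)) (le_trans (ler_normD _ _))// lerD//; exact: sup_dist_ub.
Qed.

HB.instance Definition _ := isMetric.Build R bounded_fun
  sup_distxx sup_dist_eq sup_dist_sym sup_dist_triangle.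

End bounded_functions.

Section convergence.
Variable R : realType.
Local Open Scope ereal_scope.

Lemma ereal_cvg0 (u : nat -> \bar R) : (forall j, 0 <= u j) ->
  (forall e : R, (0 < e)%R -> \forall j \near \oo, u j <= e%:E) ->
  u j @[j --> \oo] --> 0.
Proof.
move=> u0 ue; apply/fine_cvgP; split.
  apply: filterS (ue _ ltr01) => j uj.
  by rewrite ge0_fin_numE// (le_lt_trans uj)// ltry.
apply/cvgrPdist_le => e e0; apply: filterS (ue e e0) => j uj /=.
rewrite sub0r normrN ger0_norm ?fine_ge0//.
by rewrite -lee_fin fineK// ge0_fin_numE// (le_lt_trans uj)// ltry.
Qed.

Lemma hausdorff_dist_ge0 (Z : Type) (d : Z -> Z -> \bar R) A B :
  0 <= hausdorff_dist d A B.
Proof. by apply: le_ereal_inf_tmp => _ [r [r0 _ _] <-]; rewrite lee_fin. Qed.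

(** Two parametrizations of sets by the same set, uniformly [r]-close, bound
    the Hausdorff distance: corresponding points match. *)
Lemma hausdorff_dist_image_le (Z T : Type) (d : Z -> Z -> \bar R) (A : set T)
    (f g : T -> Z) (r : R) : (0 <= r)%R -> (forall x, A x -> d (f x) (g x) <= r%:E) ->
  hausdorff_dist d (f @` A) (g @` A) <= r%:E.
Proof.
move=> r0 fg; apply: ereal_inf_lbound; exists r => //; split=> //.
  by move=> _ [x Ax <-]; exists (g x); [exists x|exact: fg].
by move=> _ [x Ax <-]; exists (f x); [exists x|exact: fg].
Qed.

Lemma metric_pair_dist_ge0 (T T' : Type) (X A : set T) dX (Y B : set T') dY :
  0 <= @metric_pair_dist R T X dX A T' Y dY B.
Proof.
apply: le_ereal_inf_tmp => _ [Z [phi [psi [_ _ ->]]]].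
by rewrite adde_ge0// hausdorff_dist_ge0.
Qed.

Lemma timed_hausdorff_dist_ge0 (T T' : Type) (X : set T) dX tX (Y : set T') dY tY :
  0 <= @timed_hausdorff_dist R T X dX tX T' Y dY tY.
Proof. by apply: le_ereal_inf_tmp => _ [xs [ys [_ _ ->]]]; exact: hausdorff_dist_ge0. Qed.

Section close_metrics.
Variables (T : Type) (X : set T) (d d' : T -> T -> R) (e : R).
Hypothesis e0 : (0 <= e)%R.
Hypothesis close : forall x y, X x -> X y -> (`|d x y - d' x y| <= e)%R.

Section kuratowski.
Variable k : T -> T -> R.
Hypothesis met : is_metric X k.
Hypothesis bnd : forall x, X x -> exists C, forall y, X y -> (k x y <= C)%R.

(** The function is cut off outside [X], where nothing is known on [k]. *)
Definition kuratowski_fun (x y : T) : R := if `[< X x /\ X y >] then k x y else 0%R.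

Lemma kuratowski_bounded x : `[< exists C, forall y, (`|kuratowski_fun x y| <= C)%R >].
Proof.
apply/asboolP; rewrite /kuratowski_fun; have [Xx|nXx] := pselect (X x); last first.
  by exists 0%R => y; case: asboolP => [[]//|_]; rewrite normr0.
have [C CP] := bnd Xx; exists `|C|%R => y; case: asboolP => [[_ Xy]|_]; last by rewrite normr0.
rewrite ger0_norm; last exact: (metric_ge0 met Xx Xy).
by rewrite (le_trans (CP y Xy))// ler_norm.
Qed.

Definition kuratowski (x : T) : bounded_fun R T :=
  exist (fun f : T -> R => is_true `[< exists C, forall y, (`|f y| <= C)%R >])
    _ (kuratowski_bounded x).

(** The supremum of [|k x z - k y z|] is at most [k x y] by the triangle
    inequality, and it is attained at [z = y]. *)
Lemma kuratowski_isometric : isometric_on X k kuratowski.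
Proof.
move=> x y Xx Xy; apply: le_anti; apply/andP; split.
  apply: sup_dist_le => [|z]; first exact: (metric_ge0 met Xx Xy).
  rewrite /= /kuratowski_fun; have [Xz|nXz] := pselect (X z).
    rewrite !asboolT//; have := metric_quad met Xx Xz Xy Xz.
    by rewrite (metric_refl met Xz) addr0.
  by rewrite !asboolF ?subrr ?normr0 ?(metric_ge0 met)//; move=> [].
have := sup_dist_ub (kuratowski x) (kuratowski y) y.
rewrite /= /kuratowski_fun !asboolT// (metric_refl met Xy) subr0.
by rewrite ger0_norm// (metric_ge0 met).
Qed.
End kuratowski.

Hypothesis metd : is_metric X d.
Hypothesis metd' : is_metric X d'.
Hypothesis bndd : forall x, X x -> exists C, forall y, X y -> (d x y <= C)%R.
Hypothesis bndd' : forall x, X x -> exists C, forall y, X y -> (d' x y <= C)%R.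

(** The two Kuratowski embeddings of [X] land in the same space of bounded
    functions and differ there by at most [e]; the bound [e + e] accounts for
    [X] and for [A]. *)
Lemma metric_pair_dist_le (A : set T) : A `<=` X ->
  metric_pair_dist X d A X d' A <= (e + e)%:E.
Proof.
move=> AX.
pose phi := kuratowski metd bndd; pose psi := kuratowski metd' bndd'.
have phipsi x : X x -> (mdist (phi x) (psi x))%:E <= e%:E.
  move=> Xx; rewrite lee_fin; apply: sup_dist_le => // y.
  rewrite /= /kuratowski_fun; case: asboolP => [[_ Xy]|_]; first exact: close.
  by rewrite subrr normr0.
apply: (@le_trans _ _ (
    hausdorff_dist (fun z w : bounded_fun R T => (mdist z w)%:E) (phi @` X) (psi @` X) +
    hausdorff_dist (fun z w : bounded_fun R T => (mdist z w)%:E) (phi @` A) (psi @` A))).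
  apply: ereal_inf_lbound; exists (bounded_fun R T), phi, psi.
  by split=> //; exact: kuratowski_isometric.
rewrite EFinD; apply: leeD; apply: hausdorff_dist_image_le => // x Ax.
by apply: phipsi; exact: AX.
Qed.

(** With a common dense sequence the timed-Frechet maps are [e]-close in each
    coordinate, the time coordinates being equal. *)
Lemma timed_hausdorff_dist_le (tau : T -> R) xs :
  dense_seq X d xs -> dense_seq X d' xs ->
  timed_hausdorff_dist X d tau X d' tau <= e%:E.
Proof.
move=> dxs dxs'; apply: (@le_trans _ _ (hausdorff_dist (@linf_dist R)
   (timed_frechet d tau xs @` X) (timed_frechet d' tau xs @` X))).
  by apply: ereal_inf_lbound; exists xs, xs.
apply: hausdorff_dist_image_le => // x Xx.
apply: ge_ereal_sup => _ [[|i] _ <-]; rewrite lee_fin /=.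
  by rewrite subrr normr0.
by apply: close => //; have [+ _] := dxs; apply.
Qed.
End close_metrics.
End convergence.

(** * The null distances of the sequence *)

Section slab_topology.
Variables (R : realType) (M : topologicalType) (T : R).
Hypothesis T0 : 0 < T.
Local Notation point := (R * M)%type.
Local Notation slab := (@slab R M T).
Local Notation cslab := (@closed_slab R M T).

Lemma slab_sub : slab `<=` cslab.
Proof. by move=> p /andP[/ltW p0 /ltW pT]; rewrite /closed_slab/= p0. Qed.

Lemma slab_open : open slab.
Proof.
have -> : slab = fst @^-1` `]0, T[ by apply/seteqP; split=> p /=; rewrite in_itv.
by apply: open_comp => [p _|]; [exact: cvg_fst|exact: itv_open].
Qed.

Lemma cslab_compact : compact [set: M] -> compact cslab.
Proof.
move=> cM; have -> : cslab = `[0, T] `*` [set: M].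
  by apply/seteqP; split=> p /=; rewrite in_itv/=; [split|case].
by apply: compact_setX => //; exact: segment_compact.
Qed.

(** The approximating point is taken on the same vertical line, moved towards
    the middle of the slab; null distances along vertical lines are known
    exactly. *)
Lemma slab_vertical_dense (p : point) U : cslab p -> nbhs p U ->
  exists2 t, 0 < t < T & U (t, p.2).
Proof.
move=> /andP[p0 pT] nU.
have c : (t, p.2) @[t --> p.1] --> p.
  rewrite [X in _ --> X]surjective_pairing.
  have c1 : t @[t --> p.1] --> p.1 by exact: cvg_id.
  have c2 : p.2 @[t --> p.1] --> p.2 by exact: cvg_cst.
  exact: cvg_pair c1 c2.
have /nbhs_ballP[r /= r0 rU] := c _ nU.
pose s := Num.min (r / 2) (T / 4).
have s0 : 0 < s by rewrite lt_min !divr_gt0.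
have sr : s < r.
  by rewrite gt_min; apply/orP; left; rewrite ltr_pdivrMr// ltr_pMr// ltr1n.
have sT : s <= T / 4 by rewrite ge_min lexx orbT.
have [pT2|pT2] := leP p.1 (T / 2).
  exists (p.1 + s); first by apply/andP; split; lra.
  by apply: rU; rewrite -ball_normE /ball_/= opprD addNKr normrN gtr0_norm.
exists (p.1 - s); first by apply/andP; split; lra.
by apply: rU; rewrite -ball_normE /ball_/= opprB addrC subrK gtr0_norm.
Qed.

Lemma slab_dense (p : point) U : cslab p -> nbhs p U -> exists2 q, slab q & U q.
Proof.
by move=> cp nU; have [t tT Ut] := slab_vertical_dense cp nU; exists (t, p.2).
Qed.

Lemma near_time (p : point) (e : R) : 0 < e -> nbhs p [set q : point | `|q.1 - p.1| < e].
Proof.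
move=> e0; have c1 : z.1 @[z --> p] --> p.1 by exact: cvg_fst.
by have /cvgrPdist_lt/(_ _ e0) := c1; apply: filterS => z; rewrite distrC.
Qed.

End slab_topology.

Section null_distances.
Variables (R : realType) (n : nat) (M : topologicalType).
Variables (A : charts 'rV[R]_n.+1 M) (T : R).
Variables (h : nat -> tensor2 (time_charts A)) (hbar : nat -> R -> tensor2 A).
Variable htilde : tensor2 A.
Hypothesis hausM : hausdorff_space M.
Hypothesis atlasA : smooth_atlas A.
Hypothesis compM : compact [set: M].
Hypothesis T0 : 0 < T.
Hypothesis cosmo : forall j, cosmological T (h j).
Hypothesis ext : forall j, extends_to_closed_slab T (h j) (hbar j).
Hypothesis hmono : forall j t, 0 <= t <= T -> tensor_le (hbar j t) (hbar j.+1 t).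
Hypothesis riem : riemannian htilde.
Hypothesis hle : forall j t, 0 <= t <= T -> tensor_le (hbar j t) htilde.

Local Notation point := (R * M)%type.
Local Notation slab := (@slab R M T).
Local Notation cslab := (@closed_slab R M T).
Local Notation d j := (null_dist T (h j)).
Local Notation dbar j := (null_dist_bar T (h j)).

Let oo (t : R) : 0 < t < T -> 0 <= t <= T.
Proof. by move=> /andP[/ltW-> /ltW->]. Qed.

Let hle' j t : 0 < t < T -> tensor_le (hbar j t) htilde.
Proof. by move=> /oo; exact: hle. Qed.

Lemma reach_succ j p q L : reach T (h j.+1) p q L -> reach T (h j) p q L.
Proof.
apply: (reach_mono (cosmo j) (ext j) (cosmo j.+1) (ext j.+1)) => t /oo.
exact: hmono.
Qed.

Lemma reach0 j p q L : reach T (h j) p q L -> reach T (h 0) p q L.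
Proof. by elim: j => // j IH /reach_succ. Qed.

Lemma reach_near (p : point) (e : R) : 0 < e ->
  exists2 U, nbhs p U & forall j y z, U y -> U z -> slab y -> slab z ->
    exists2 L, L <= e & reach T (h j) y z L.
Proof.
move=> e0; have [r [U [r0 nU UP]]] := reach_locally atlasA T0 riem p.2 e0.
exists ([set q : point | `|q.1 - p.1| < r / 2] `&` [set q | U q.2]).
  apply: filterI; first by apply: near_time; rewrite divr_gt0.
  have c2 : z.2 @[z --> p] --> p.2 by exact: cvg_snd.
  exact: c2.
move=> j [t y] [t' z] [/= ty Uy] [/= tz Uz] sy sz.
apply: (UP y z Uy Uz _ _ (cosmo j) (ext j) (@hle' j) _ _ sy sz).
rewrite -(subrKA p.1) (le_lt_trans (ler_normD _ _))// (splitr r) ltrD//.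
by rewrite distrC.
Qed.

(** The points joined to [p] with a bound independent of [j] form a subset of
    the connected slab which is open and closed by the local estimate. *)
Lemma reach_all (p q : point) : slab p -> slab q ->
  exists C, forall j, exists2 L, L <= C & reach T (h j) p q L.
Proof.
move=> sp; move: q.
pose B := [set q | slab q /\ exists C, forall j, exists2 L, L <= C & reach T (h j) p q L].
have BP q' q U : (forall j y z, U y -> U z -> slab y -> slab z ->
    exists2 L, L <= 1 & reach T (h j) y z L) -> U q' -> B q' -> U q -> slab q -> B q.
  move=> UP Uq' [sq' [C CP]] Uq sq; split=> //; exists (C + 1) => j.
  have [L LC r1] := CP j; have [L' L'1 r2] := UP j _ _ Uq' Uq sq' sq.
  by exists (L + L'); [rewrite lerD|exact: reach_trans r1 r2].
have BE : B = slab.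
  apply: (cosmo_connected (cosmo 0)).
  - by exists p; split=> //; exists 0 => j; exists 0 => //; exact: reach_refl.
  - exists B; last by apply/seteqP; split=> [q [sq ?]|q [_ ?]].
    rewrite openE => q Bq; have [sq _] := Bq.
    have [U nU UP] := reach_near q ltr01.
    have nS : nbhs q slab by apply: open_nbhs_nbhs; split=> //; exact: slab_open.
    apply: filterS (filterI nU nS) => z [Uz sz].
    by apply: (BP q z U UP) => //; exact: nbhs_singleton.
  - exists (closure B); first exact: closed_closure.
    apply/seteqP; split=> [q Bq|q [sq clq]].
      by split; [case: Bq|exact: subset_closure].
    have [U nU UP] := reach_near q ltr01.
    have [z [Bz Uz]] := clq U nU.
    by apply: (BP z q U UP) => //; exact: nbhs_singleton.
by move=> q; rewrite -BE => -[].
Qed.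

Let reach_ex j p q : slab p -> slab q -> exists L, reach T (h j) p q L.
Proof.
by move=> sp sq; have [C /(_ j)[L _ r]] := reach_all sp sq; exists L.
Qed.

Lemma null_dist_refl j p : slab p -> d j p p = 0.
Proof.
move=> sp; have r := reach_refl (h j) sp; apply: le_anti.
rewrite (null_dist_le r)/=; have := null_dist_time r.
by rewrite subrr normr0.
Qed.

Lemma null_dist_sym j p q : slab p -> slab q -> d j p q = d j q p.
Proof.
suff H p' q' : slab p' -> slab q' -> d j p' q' <= d j q' p'.
  by move=> sp sq; apply: le_anti; rewrite !H.
move=> sp sq; apply/ler_addgt0Pr => e e0; have [L r] := reach_ex j sq sp.
have [L' r' lt] := null_dist_approx r e0; apply: ltW; apply: le_lt_trans lt.
exact/null_dist_le/(reach_sym atlasA (cosmo j) (ext j)).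
Qed.

Lemma null_dist_triangle j p q r : slab p -> slab q -> slab r ->
  d j p r <= d j p q + d j q r.
Proof.
move=> sp sq sr; apply/ler_addgt0Pr => e e0.
have e20 : 0 < e / 2 by rewrite divr_gt0.
have [L1 r1] := reach_ex j sp sq; have [L2 r2] := reach_ex j sq sr.
have [L1' r1' lt1] := null_dist_approx r1 e20.
have [L2' r2' lt2] := null_dist_approx r2 e20.
by have := null_dist_le (reach_trans atlasA r1' r2'); lra.
Qed.

Lemma null_dist_ge_time j p q : slab p -> slab q -> `|p.1 - q.1| <= d j p q.
Proof. by move=> sp sq; have [L r] := reach_ex j sp sq; exact: null_dist_time r. Qed.

Lemma null_dist_mono j p q : slab p -> slab q -> d j p q <= d j.+1 p q.
Proof.
move=> sp sq; apply/ler_addgt0Pr => e e0; have [L r] := reach_ex j.+1 sp sq.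
have [L' r' lt] := null_dist_approx r e0; apply: ltW; apply: le_lt_trans lt.
exact/null_dist_le/reach_succ.
Qed.

Lemma null_dist_near (p : point) (e : R) : 0 < e ->
  exists2 U, nbhs p U & forall j y z, U y -> U z -> slab y -> slab z -> d j y z <= e.
Proof.
move=> e0; have [U nU UP] := reach_near p e0; exists U => // j y z Uy Uz sy sz.
by have [L Le r] := UP j y z Uy Uz sy sz; exact: le_trans (null_dist_le r) Le.
Qed.

Let d_near1 j (p : point) (e : R) : cslab p -> 0 < e ->
  exists2 U, nbhs p U & forall y z, U y -> U z -> slab y -> slab z -> d j y z <= e.
Proof.
by move=> _ e0; have [U nU UP] := null_dist_near p e0; exists U => // y z; exact: UP.
Qed.

Let d_sep j (p q : point) : cslab p -> cslab q -> p <> q ->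
  exists U V e, [/\ nbhs p U, nbhs q V, 0 < e &
    forall x y, U x -> V y -> slab x -> slab y -> e <= d j x y].
Proof.
move=> cp cq pq.
have [U [V [e [nU nV e0 UVe]]]] := reach_separated atlasA hausM (cosmo 0) (ext 0) cp pq.
exists U, V, e; split=> // x y Ux Vy sx sy; have [L r] := reach_ex j sx sy.
apply: lb_le_inf; first by exists L.
by move=> L' r'; apply: UVe Ux Vy _; exact: reach0 r'.
Qed.

Let dense := @slab_dense R M T T0.
Let sub := @slab_sub R M T.

Lemma null_dist_bar_approx j (p q : point) (e : R) : cslab p -> cslab q -> 0 < e ->
  exists U V, [/\ nbhs p U, nbhs q V & forall x y, U x -> V y -> slab x -> slab y ->
    `|dbar j p q - d j x y| < e].
Proof. exact: (lim_approx dense (@null_dist_sym j) (@null_dist_triangle j) (@d_near1 j)). Qed.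

Lemma null_dist_bar_le j U V (p q : point) (c : R) : cslab p -> cslab q -> nbhs p U -> nbhs q V ->
  (forall x y, U x -> V y -> slab x -> slab y -> d j x y <= c) -> dbar j p q <= c.
Proof. exact: (lim_le dense (@null_dist_sym j) (@null_dist_triangle j) (@d_near1 j)). Qed.

Lemma null_dist_bar_ge j U V (p q : point) (c : R) : cslab p -> cslab q -> nbhs p U -> nbhs q V ->
  (forall x y, U x -> V y -> slab x -> slab y -> c <= d j x y) -> c <= dbar j p q.
Proof. exact: (lim_ge dense (@null_dist_sym j) (@null_dist_triangle j) (@d_near1 j)). Qed.

Lemma null_dist_bar_agree j (p q : point) : slab p -> slab q -> dbar j p q = d j p q.
Proof. exact: (lim_agree sub dense (@null_dist_sym j) (@null_dist_triangle j) (@d_near1 j)). Qed.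

Lemma null_dist_bar_metric j : is_metric cslab (dbar j).
Proof.
exact: (lim_is_metric dense (@null_dist_refl j) (@null_dist_sym j) (@null_dist_triangle j) (@d_near1 j) (@d_sep j)).
Qed.

Lemma null_dist_bar_near (p : point) (e : R) : cslab p -> 0 < e ->
  exists2 U, nbhs p U & forall j y z, U y -> U z -> cslab y -> cslab z -> dbar j y z <= e.
Proof.
move=> _ e0; have [U nU UP] := null_dist_near p e0; exists (U^°); first exact: nbhs_interior.
by move=> j y z Uy Uz cy cz; apply: (null_dist_bar_le cy cz Uy Uz) => x x'; exact: UP.
Qed.

Lemma null_dist_bar_mono j (p q : point) : cslab p -> cslab q -> dbar j p q <= dbar j.+1 p q.
Proof.
move=> cp cq; apply/ler_addgt0Pr => e e0.
have [U [V [nU nV UV]]] := null_dist_bar_approx j.+1 cp cq e0.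
apply: (null_dist_bar_le cp cq nU nV) => x y Ux Vy sx sy.
have := UV x y Ux Vy sx sy; have := null_dist_mono j sx sy.
by rewrite ltr_norml => h1 /andP[h2 h3]; lra.
Qed.

Lemma null_dist_bar_bounded (p q : point) : cslab p -> cslab q ->
  exists C, forall j, dbar j p q <= C.
Proof.
move=> cp cq.
have [U nU UP] := null_dist_near p ltr01; have [V nV VP] := null_dist_near q ltr01.
have [x sx Ux] := dense cp nU; have [y sy Vy] := dense cq nV.
have [C CP] := reach_all sx sy.
exists (1 + (C + 1)) => j; apply: (null_dist_bar_le cp cq nU nV) => x' y' Ux' Vy' sx' sy'.
have [L LC r] := CP j; have := null_dist_le r.
have := null_dist_triangle j sx' sx sy'; have := null_dist_triangle j sx sy sy'.
by have := UP j _ _ Ux' Ux sx' sx; have := VP j _ _ Vy Vy' sy sy'; lra.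
Qed.

Lemma null_dist_bar_time j (p q : point) : cslab p -> cslab q -> `|p.1 - q.1| <= dbar j p q.
Proof.
move=> cp cq; apply/ler_addgt0Pr => e e0; rewrite -lerBlDr.
have e20 : 0 < e / 2 by rewrite divr_gt0.
apply: (null_dist_bar_ge cp cq (near_time p e20) (near_time q e20)) => x y /= xp yq sx sy.
have := null_dist_ge_time j sx sy.
have -> : p.1 - q.1 = (p.1 - x.1) + (x.1 - y.1) + (y.1 - q.1) by ring.
have := ler_normD (p.1 - x.1 + (x.1 - y.1)) (y.1 - q.1).
have := ler_normD (p.1 - x.1) (x.1 - y.1).
by move: xp; rewrite distrC; lra.
Qed.

(** The extended distance is approached along points of the same vertical
    line, which are joined by a vertical curve. *)
Lemma null_dist_bar_vertical j (x : M) t : 0 <= t <= T -> dbar j (t, x) (0, x) <= t.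
Proof.
move=> tT; apply/ler_addgt0Pr => e e0.
have e30 : 0 < e / 3 by rewrite divr_gt0.
have ct : cslab (t, x) by [].
have c0 : cslab (0, x) by rewrite /closed_slab/= lexx ltW.
have [U [V [nU nV UV]]] := null_dist_bar_approx j ct c0 e30.
have [t1 t1T [U1 t1t]] := slab_vertical_dense T0 ct (filterI nU (near_time (t, x) e30)).
have [t2 t2T [V2 t20]] := slab_vertical_dense T0 c0 (filterI nV (near_time (0, x) e30)).
rewrite /= in U1 t1t V2 t20.
have [sk _ _] := riem.
have r := reach_vertical atlasA (cosmo j) (ext j) (@hle' j) sk x t1T t2T.
have uv := le_lt_trans (ler_norm _) (UV _ _ U1 V2 t1T t2T).
have tt : `|t2 - t1| <= t + 2 * (e / 3).
  move: t1t t20; rewrite !ltr_norml => /andP[? ?] /andP[? ?]; case/andP: tT => ? ?.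
  by rewrite ler_norml; apply/andP; split; lra.
by have := null_dist_le r; lra.
Qed.

End null_distances.

(** * The theorem *)

(** The image of a chart is open in a space of positive dimension. *)
Lemma chart_two_points (R : realType) (n : nat) (M : topologicalType)
    (A : charts 'rV[R]_n.+1 M) (x : M) : smooth_atlas A -> exists y, x <> y.
Proof.
move=> atlasA; have [i dx] := dom_cover atlasA x.
have ix : (coord i @` dom i) (coord i x) by exists x.
have := open_nbhs_nbhs (conj (image_open atlasA i) ix) => /nbhs_ballP[r /= r0 rP].
pose y := coord i x + const_mx (r / 2).
have /(paramK atlasA)[dy cy] : (coord i @` dom i) y.
  apply: rP; rewrite -ball_normE /ball_/= opprD addNKr normrN.
  apply: (@le_lt_trans _ _ (r / 2)); last by rewrite ltr_pdivrMr// ltr_pMr// ltr1n.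
  apply: norm_le_coord => [|a]; first by rewrite divr_ge0// ltW.
  by rewrite mxE ger0_norm// divr_ge0// ltW.
exists (param i y) => xy; move: cy; rewrite -xy => /rowP/(_ 0).
by rewrite !mxE => /eqP; rewrite -subr_eq0 opprD addNKr oppr_eq0 gt_eqF// divr_gt0.
Qed.

(** Vertical lines show that the initial slice is at distance at most [t],
    and the Lipschitz property that it is not closer. *)
Lemma slab_future_developed (R : realType) (M : topologicalType) (T : R)
    (D : R * M -> R * M -> R) : 0 < T -> (exists x y : M, x <> y) ->
  is_metric (@closed_slab R M T) D ->
  (forall p q, closed_slab T p -> closed_slab T q -> `|p.1 - q.1| <= D p q) ->
  (forall x t, 0 <= t <= T -> D (t, x) (0, x) <= t) ->
  future_developed (@closed_slab R M T) D (fun p => p.1).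
Proof.
move=> T0 [x [y xy]] metD lipD verD.
have c0 z : closed_slab T (0 : R, z : M) by rewrite /closed_slab/= lexx ltW.
split.
- by split=> // p /andP[].
- by exists (0, x), (0, y); split=> // -[].
- move=> p cp; apply: le_anti; apply/andP; split.
    apply: lb_le_inf; first by exists (D p (0, x)), (0, x).
    move=> _ [a [ca a0] <-]; rewrite (le_trans _ (lipD p a cp ca))//.
    by rewrite [a.1]a0 subr0 ler_norm.
  apply: (@le_trans _ _ (D p (0, p.2))).
    apply: ge_inf; last by exists (0, p.2).
    by exists 0 => _ [a [ca _] <-]; rewrite (metric_ge0 metD cp ca).
  by rewrite [X in D X](surjective_pairing p) verD.
Qed.

Theorem theorem1p2 (R : realType) (n : nat) (M : topologicalType)
    (A : charts 'rV[R]_n.+1 M) (tmax : R)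
    (h : nat -> tensor2 (time_charts A)) (hbar : nat -> R -> tensor2 A)
    (htilde : tensor2 A) :
  hausdorff_space M -> smooth_atlas A -> compact [set: M] -> 0 < tmax ->
  (forall j, cosmological tmax (h j)) ->
  (forall j, extends_to_closed_slab tmax (h j) (hbar j)) ->
  (forall j t, 0 <= t <= tmax -> tensor_le (hbar j t) (hbar j.+1 t)) ->
  riemannian htilde ->
  (forall j t, 0 <= t <= tmax -> tensor_le (hbar j t) htilde) ->
  let N : set (R * M) := @slab R M tmax in
  let Nbar : set (R * M) := @closed_slab R M tmax in
  let d j : R * M -> R * M -> R := null_dist tmax (h j) in
  let dbar j : R * M -> R * M -> R := null_dist_bar tmax (h j) in
  let dinf (p q : R * M) : R := lim (dbar j p q @[j --> \oo]) in
  let time (p : R * M) : R := p.1 in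
  [/\ forall j, is_completion N (d j) Nbar (dbar j) /\
                induces_topology Nbar (dbar j),
      {uniform Nbar `*` Nbar,
         (fun j x => dbar j x.1 x.2) @ \oo --> (fun x => dinf x.1 x.2)},
      metric_compact Nbar dinf,
      future_developed_cvg (fun=> Nbar) dbar (fun=> time) Nbar dinf time
    & timed_hausdorff_cvg (fun=> Nbar) dbar (fun=> time) Nbar dinf time].
Proof.
move=> hausM atlasA compM T0 cosmo ext hmono riem hle N Nbar d dbar dinf time.
have compN : compact Nbar by exact: cslab_compact.
have met j : is_metric Nbar (dbar j).
  exact: (null_dist_bar_metric hausM atlasA T0 cosmo ext hmono riem hle).
have mono j p q : Nbar p -> Nbar q -> dbar j p q <= dbar j.+1 p q.
  exact: (null_dist_bar_mono atlasA T0 cosmo ext hmono riem hle).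
have bounded p q : Nbar p -> Nbar q -> exists C, forall j, dbar j p q <= C.
  exact: (null_dist_bar_bounded atlasA T0 cosmo ext riem hle).
have equicont p (e : R) : Nbar p -> 0 < e -> exists2 U, nbhs p U &
    forall j y z, U y -> U z -> Nbar y -> Nbar z -> dbar j y z <= e.
  exact: (null_dist_bar_near atlasA T0 cosmo ext riem hle).
have ledinf j p q := @le_dinf _ _ _ _ mono bounded j p q.
have metinf : is_metric Nbar dinf := dinf_is_metric met mono bounded.
have near_of (D : R * M -> R * M -> R) : (forall p (e : R), Nbar p -> 0 < e ->
     exists2 U, nbhs p U & forall y z, U y -> U z -> Nbar y -> Nbar z -> D y z <= e) ->
    forall p (e : R), Nbar p -> 0 < e -> \forall q \near p, Nbar q -> D p q < e.
  move=> DU p e Np e0; have e20 : 0 < e / 2 by rewrite divr_gt0.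
  have [U nU UP] := DU p _ Np e20; have Up := nbhs_singleton nU.
  apply: filterS nU => q Uq Nq; rewrite (le_lt_trans (UP _ _ Up Uq Np Nq))//.
  by rewrite ltr_pdivrMr// ltr_pMr// ltr1n.
have cont j p (e : R) : Nbar p -> 0 < e -> \forall q \near p, Nbar q -> dbar j p q < e.
  apply: near_of => {}p {}e Np e0; have [U nU UP] := equicont p e Np e0.
  by exists U => // y z; exact: UP.
have continf p (e : R) : Nbar p -> 0 < e -> \forall q \near p, Nbar q -> dinf p q < e.
  apply: near_of => {}p {}e Np e0.
  by have [U nU UP] := dinf_cont mono bounded equicont Np e0; exists U.
have lip j p q : Nbar p -> Nbar q -> `|p.1 - q.1| <= dbar j p q.
  exact: (null_dist_bar_time atlasA T0 cosmo ext riem hle).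
have lipinf p q : Nbar p -> Nbar q -> `|p.1 - q.1| <= dinf p q.
  by move=> Np Nq; rewrite (le_trans (lip 0%N p q Np Nq))// ledinf.
have vert j x t : 0 <= t <= tmax -> dbar j (t, x) (0, x) <= t.
  exact: (null_dist_bar_vertical atlasA T0 cosmo ext riem hle).
have N0 (x : M) : Nbar (0, x) by rewrite /Nbar /closed_slab/= lexx ltW.
have vertinf x t : 0 <= t <= tmax -> dinf (t, x) (0, x) <= t.
  by move=> tT; apply: (dinf_le mono bounded) => // j; exact: vert.
have [p0 Np0] : exists p0, Nbar p0.
  by have [p0 /slab_sub Np0] := cosmo_nonempty (cosmo 0%N); exists p0.
have twoM : exists x y : M, x <> y.
  by have [y py] := chart_two_points p0.2 atlasA; exists p0.2, y.
have fd j : future_developed Nbar (dbar j) time.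
  exact: (slab_future_developed T0 twoM (met j) (lip j) (vert j)).
have fdinf : future_developed Nbar dinf time.
  exact: (slab_future_developed T0 twoM metinf lipinf vertinf).
have unif (e : R) : 0 < e -> \forall j \near \oo,
    forall x y, Nbar x -> Nbar y -> `|dbar j x y - dinf x y| <= e.
  exact: (dinf_uniform compN met mono bounded equicont).
have bnd j p : Nbar p -> exists C, forall q, Nbar q -> dbar j p q <= C.
  exact: (compact_metric_bounded compN (met j) (cont j)).
have bndinf p : Nbar p -> exists C, forall q, Nbar q -> dinf p q <= C.
  exact: (compact_metric_bounded compN metinf continf).
have compinf : metric_compact Nbar dinf := compact_metric_compact compN continf.
split=> //.
- move=> j; split; last exact: (compact_induces_topology compN (met j) (cont j)).
  split=> //.
  + exact: (compact_metric_complete compN (met j) (cont j)).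
  + exact: slab_sub.
  + exact: (null_dist_bar_agree atlasA T0 cosmo ext riem hle).
  + move=> p e Np e0; have [q Nq pq] := slab_dense T0 Np (cont j p e Np e0).
    by exists q => //; apply: pq; exact: slab_sub.
- exact: (dinf_uniform_cvg compN met mono bounded equicont).
- split=> //; apply: ereal_cvg0 => [j|e e0]; first exact: metric_pair_dist_ge0.
  have e20 : 0 < e / 2 by rewrite divr_gt0.
  apply: filterS (unif _ e20) => j jP; rewrite [e in leRHS]splitr.
  apply: (metric_pair_dist_le (ltW e20) jP (met j) metinf (bnd j) bndinf).
  by move=> p [].
- split.
  + by move=> j; split; [exact: fd_timed (fd j)|exact: (compact_metric_compact compN (cont j))].
  + by split=> //; exact: fd_timed fdinf.
  apply: ereal_cvg0 => [j|e e0]; first exact: timed_hausdorff_dist_ge0.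
  have [xs [xsN dxs]] := compact_dense_seq compN continf (ex_intro _ p0 Np0).
  apply: filterS (unif _ e0) => j jP.
  apply: (@timed_hausdorff_dist_le _ _ _ _ _ _ (ltW e0) jP _ xs) => //; split=> // x r Nx r0.
  have [i ir] := dxs x r Nx r0; exists i.
  by rewrite (le_lt_trans _ ir)// ledinf.
Qed.
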